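(* For each $n$, let $\mathbf R_n$ be the probability measure defined via $\mathbf R_n(B)=E_n(B)$ for all axis-parallel rectangles $B\subseteq[0,1]^2$. Then the measures $\mathbf R_n$ converge to $\mathbf R$ as $n\to\infty$.
   Context: $S_n$ is the set of permutations of $[n]$. An (ascending) run of $\pi$ is a maximal block of consecutive positions on which the entries are increasing; $\mathsf{runsort}(\pi)$ is obtained by reordering the runs (each kept intact) so that their first entries appear in increasing order. For $i,j\in[n]$, $p_n(i,j)$ is the probability that the entry $j$ is in the $i$-th position of $\mathsf{runsort}(\pi)$ for $\pi$ uniform in $S_n$. For $B=[x_1,x_2]\times[y_1,y_2]$, $E_n(B)=\frac1n\sum_{x_1n<i\le x_2n,\ y_1n<j\le y_2n}p_n(i,j)$ (so $\mathbf R_n$ places mass $p_n(i,j)/n$ at $(i/n,j/n)$). Let $\mathcal C=\{(x,y)\in[0,1]^2:x=ye^{1-y}\}$, $\mathcal C^+=\{(x,y)\in[0,1]^2:x<ye^{1-y}\}$, and $\mathbf R(B)=\int_{B\cap\mathcal C^+}e^{y-1}\,dx\,dy+\int_{B\cap\mathcal C}(1-y)\,dy$ (the second integral in the coordinate $y$ parametrizing $\mathcal C$). Convergence is in the weak topology on probability measures on $[0,1]^2$. *)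

(* Defs.v *)
From HB Require Import structures.
From mathcomp Require Import all_boot all_order all_algebra all_fingroup.
From mathcomp Require Import all_classical all_reals all_analysis measurable_realfun.
From mathcomp Require Import lra.

Set Implicit Arguments.
Unset Strict Implicit.
Unset Printing Implicit Defensive.

Import Order.TTheory GRing.Theory Num.Theory numFieldNormedType.Exports.

Local Open Scope classical_set_scope.
Local Open Scope ring_scope.

Fixpoint runs (s : seq nat) : seq (seq nat) :=
  if s is x :: s' then
    if runs s' is (y :: r) :: rs then
      if (x < y)%N then (x :: y :: r) :: rs else [:: x] :: (y :: r) :: rs
    else [:: [:: x]]
  else [::].

Definition runsort (s : seq nat) : seq nat :=
  flatten (sort (fun r r' => head 0 r <= head 0 r')%N (runs s)).

(* One-line notation, with values in {1, ..., n}. *)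
Definition word n (s : {perm 'I_n}) : seq nat :=
  [seq (nat_of_ord (s i)).+1 | i <- enum 'I_n].

(* i and j are 1-based and are only meant to range over {1, ..., n}. *)
Definition runsort_prob (R : realType) (n i j : nat) : R :=
  #|[pred s : {perm 'I_n} | nth 0%N (runsort (word s)) i.-1 == j]|%:R / n`!%:R.

Lemma runs_neq0 s : all (fun r => r != [::]) (runs s).
Proof.
by elim: s => //= x s; case: (runs s) => [|[|y r] rs] //=; case: ifP.
Qed.

Lemma flatten_runs s : flatten (runs s) = s.
Proof.
elim: s => //= x s; have := runs_neq0 s.
case: (runs s) => [|[|y r] rs] //= _ <- //.
by case: ifP.
Qed.

Lemma runs_increasing s : all (sorted ltn) (runs s).
Proof.
elim: s => //= x s; case: (runs s) => [|[|y r] rs] //=.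
by case: ifP => //= ->.
Qed.

Lemma runs_maximal s :
  sorted (fun r r' => head 0 r' <= last 0 r)%N (runs s).
Proof.
elim: s => //= x s; case: (runs s) => [|[|y r] rs] //=.
case: ltnP => h /=; [by case: rs | by rewrite h].
Qed.

Lemma perm_runsort s : perm_eq (runsort s) s.
Proof.
rewrite /runsort -[X in perm_eq _ X]flatten_runs.
by apply: perm_flatten; rewrite perm_sort.
Qed.

Lemma size_word n (s : {perm 'I_n}) : size (word s) = n.
Proof. by rewrite size_map size_enum_ord. Qed.

Lemma word_bounds n (s : {perm 'I_n}) x : x \in word s -> (0 < x <= n)%N.
Proof. by case/mapP => i _ ->; rewrite ltn_ord. Qed.

Section runsort_prob_theory.
Context {R : realType}.

Lemma runsort_prob_ge0 n i j : 0 <= runsort_prob R n i j.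
Proof. by rewrite /runsort_prob divr_ge0. Qed.

Lemma sum_runsort_prob n i : (0 < i <= n)%N ->
  \sum_(1 <= j < n.+1) runsort_prob R n i j = 1.
Proof.
move=> /andP[i0 ilen]; rewrite /runsort_prob -mulr_suml -natr_sum.
suff -> : (\sum_(1 <= j < n.+1) #|[pred s : {perm 'I_n} |
    nth 0%N (runsort (word s)) i.-1 == j]| = n`!)%N.
  by rewrite divff// pnatr_eq0 -lt0n fact_gt0.
under eq_bigr do rewrite -sum1_card big_mkcond.
rewrite exchange_big /= -[RHS]card_Sn -sum1_card [RHS]big_mkcond /=.
apply: eq_bigr => s _; rewrite -big_mkcond /=.
have /word_bounds/andP[v0 vn] : nth 0%N (runsort (word s)) i.-1 \in word s.
  rewrite -(perm_mem (perm_runsort _)) mem_nth//.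
  by rewrite (perm_size (perm_runsort _)) size_word prednK.
rewrite (eq_bigl (pred1 (nth 0%N (runsort (word s)) i.-1))); last first.
  by move=> j; rewrite /= eq_sym.
by rewrite sum1_count count_uniq_mem ?iota_uniq// mem_index_iota v0 ltnS vn.
Qed.

End runsort_prob_theory.

(* The Borel plane: lebesgue_measure lives on measurableTypeR R, which is R with
   its Borel sets but a display different from that of R. *)
Notation plane R := (measurableTypeR R * measurableTypeR R)%type.

Definition unit_square (R : realType) : set (plane R) :=
  [set z : R * R | 0 <= z.1 <= 1 /\ 0 <= z.2 <= 1].

(* The summation range is half-open, so this is the mass of the half-open
   rectangle ]x1, x2] x ]y1, y2]; see Rn_rect. *)
Definition En (R : realType) (n : nat) (x1 x2 y1 y2 : R) : R :=
  n%:R^-1 * \sum_(1 <= i < n.+1 | x1 * n%:R < i%:R <= x2 * n%:R)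
              \sum_(1 <= j < n.+1 | y1 * n%:R < j%:R <= y2 * n%:R)
                runsort_prob R n i j.

Definition grid_point (R : realType) (n i j : nat) : R * R :=
  (i%:R / n%:R, j%:R / n%:R).

Definition Rn (R : realType) (n : nat) : set (plane R) -> \bar R := fun A =>
  (\sum_(1 <= i < n.+1) \sum_(1 <= j < n.+1)
     (runsort_prob R n i j / n%:R)%:E * \d_(grid_point R n i j : plane R) A)%E.

Section Rn_measure.
Context {R : realType}.
Variable n : nat.

Let Rn0 : Rn n (@set0 (plane R)) = 0%E.
Proof.
rewrite /Rn big1// => i _; rewrite big1// => j _.
by rewrite measure0 mule0.
Qed.

Let weight_ge0 i j : 0 <= runsort_prob R n i j / n%:R.
Proof. by rewrite divr_ge0// runsort_prob_ge0. Qed.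

Let Rn_ge0 (A : set (plane R)) : (0 <= Rn n A)%E.
Proof.
apply: sume_ge0 => i _; apply: sume_ge0 => j _.
by rewrite mule_ge0// lee_fin.
Qed.

Let Rn_sigma_additive : semi_sigma_additive (@Rn R n).
Proof.
pose m i j := mscale (NngNum (weight_ge0 i.+1 j.+1)) \d_(grid_point R n i.+1 j.+1 : plane R).
have -> : @Rn R n = msum (fun i => msum (m i) n) n.
  apply/funext => A; rewrite /Rn /msum big_add1 big_mkord.
  by apply: eq_bigr => i _; rewrite big_add1 big_mkord.
exact: measure_semi_sigma_additive.
Qed.

HB.instance Definition _ := isMeasure.Build _ (plane R) R (@Rn R n)
  Rn0 Rn_ge0 Rn_sigma_additive.

End Rn_measure.

Section Rn_probability.
Context {R : realType}.

Lemma Rn_full n (A : set (plane R)) : @unit_square R `<=` A -> Rn n.+1 A = 1%E.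
Proof.
move=> sA; rewrite /Rn.
transitivity (\sum_(1 <= i < n.+2) (n.+1%:R^-1 : R)%:E)%E; last first.
  rewrite sumEFin big_const_nat subSS subn0 iter_addr_0.
  by rewrite -(mulr_natr _^-1) mulVf// pnatr_eq0.
have ratio k : (1 <= k < n.+2)%N -> 0 <= (k%:R / n.+1%:R : R) <= 1.
  move=> /andP[_ kn]; rewrite divr_ge0//= ler_pdivrMr ?ltr0n// mul1r ler_nat.
  by rewrite -ltnS.
rewrite !big_nat; apply: eq_bigr => i hi.
rewrite -[X in _ = (X)%:E]mul1r -(sum_runsort_prob (i := i) (n := n.+1))//.
rewrite mulr_suml -sumEFin !big_nat; apply: eq_bigr => j hj.
rewrite diracE mem_set ?mule1//; apply: sA; split; exact: ratio.
Qed.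

(* Rn 0 is the zero measure; Rn n is a probability measure only for n > 0. *)
HB.instance Definition _ n := Measure_isProbability.Build _ _ _
  (@Rn R n.+1) (Rn_full n (@subsetT _ _)).

Lemma Rn_unit_square n : Rn n.+1 (@unit_square R) = 1%E.
Proof. exact: Rn_full. Qed.

Lemma Rn_rect n (x1 x2 y1 y2 : R) : (0 < n)%N ->
  Rn n (`]x1, x2] `*` `]y1, y2]) = (En n x1 x2 y1 y2)%:E.
Proof.
move=> n0; rewrite /Rn /En mulr_sumr -sumEFin [RHS]big_mkcond /=.
apply: eq_bigr => i _.
have in_itv_n (k : nat) (a b : R) :
    (k%:R / n%:R \in `]a, b]) = (a * n%:R < k%:R <= b * n%:R).
  by rewrite in_itv/= ltr_pdivlMr ?ler_pdivrMr// ltr0n.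
have inE' j : (grid_point R n i j \in (`]x1, x2] `*` `]y1, y2])) =
    (x1 * n%:R < i%:R <= x2 * n%:R) && (y1 * n%:R < j%:R <= y2 * n%:R).
  by rewrite in_setX/= !mem_setE !in_itv_n.
case: ifPn => hi.
  rewrite mulr_sumr -sumEFin [RHS]big_mkcond /=; apply: eq_bigr => j _.
  rewrite diracE inE' hi/=; case: ifP => _; last by rewrite mule0.
  by rewrite mule1 mulrC.
by rewrite big1// => j _; rewrite diracE inE' (negbTE hi) mule0.
Qed.

End Rn_probability.

Definition Ccurve (R : realType) : set (plane R) :=
  [set z : R * R | unit_square z /\ z.1 = z.2 * expR (1 - z.2)].

Definition Cplus (R : realType) : set (plane R) :=
  [set z : R * R | unit_square z /\ z.1 < z.2 * expR (1 - z.2)].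

(* Ccurve is the graph of a function of y, so integrating in the coordinate y
   over a part of it means integrating over its second projection. *)
Definition Rlim (R : realType) : set (plane R) -> \bar R := fun A =>
  (\int[@lebesgue_measure R \x @lebesgue_measure R]_(z in A `&` @Cplus R)
     (expR (z.2 - 1))%:E +
   \int[@lebesgue_measure R]_(y in [set z.2 | z in A `&` @Ccurve R])
     (1 - y)%:E)%E.

Section Rlim_measure.
Context {R : realType}.
Local Notation phi := (fun y : R => y * expR (1 - y)).

Lemma phi_itv (y : R) : 0 <= y <= 1 -> 0 <= phi y <= 1.
Proof.
move=> /andP[y0 y1]; rewrite mulr_ge0 ?expR_ge0//=.
have := expR_ge1Dx (y - 1); rewrite addrC subrK => h.
rewrite (le_trans (ler_wpM2r (expR_ge0 _) h))// -expRD.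
by rewrite (_ : y - 1 + (1 - y) = 0) ?expR0//; lra.
Qed.

Lemma curve_snd (A : set (plane R)) : [set z.2 | z in A `&` @Ccurve R] =
  `[0, 1] `&` (fun y => (phi y, y)) @^-1` A.
Proof.
apply/seteqP; split => [y [[a b] /= [Aab [[/= _ b01] /= ab]] <-]|y [/= y01 Ay]].
  by split; [rewrite /= in_itv/= | rewrite /= -ab].
rewrite in_itv/= in y01.
by exists (phi y, y) => //; split => //; split => //; split => //=; exact: phi_itv.
Qed.

Lemma measurable_phi : measurable_fun [set: R] phi.
Proof.
apply: measurable_funM => //; apply: measurableT_comp => //.
exact: measurable_funB.
Qed.

Lemma measurable_curve_snd (A : set (plane R)) : measurable A ->
  measurable [set z.2 | z in A `&` @Ccurve R].
Proof.
move=> mA; rewrite curve_snd; apply: measurableI => //.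
rewrite -[X in measurable X]setTI.
suff : measurable_fun [set: R] (fun y : R => (phi y, y)) by exact.
apply/measurable_fun_pairP; split => /=; first exact: measurable_phi.
exact: measurable_id.
Qed.

Lemma measurable_unit_square : measurable (@unit_square R).
Proof.
rewrite (_ : @unit_square R = `[0, 1] `*` `[0, 1]).
  exact: measurableX.
by apply/seteqP; split => -[a b] /= [h1 h2]; split; move: h1 h2;
  rewrite /= !in_itv.
Qed.

Lemma measurable_Cplus : measurable (@Cplus R).
Proof.
rewrite (_ : @Cplus R = @unit_square R `&`
  [set z | z.1 < z.2 * expR (1 - z.2)])//.
apply: measurableI; first exact: measurable_unit_square.
rewrite -[X in measurable X]setTI.
rewrite (_ : [set z | _] =
  (fun z : R * R => z.1 < phi z.2) @^-1` [set true]); last first.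
  by apply/seteqP; split => z.
apply: measurable_fun_ltr => //.
apply: (measurableT_comp measurable_phi).
exact: measurable_snd.
Qed.

Let dens1 (z : R * R) : \bar R := (expR (z.2 - 1))%:E.
Let dens2 (y : R) : \bar R := (1 - y)%:E.

Let mdens1 : measurable_fun setT dens1.
Proof.
apply/measurable_EFinP; apply: measurableT_comp => //.
by apply: measurable_funB.
Qed.

Let mdens2 : measurable_fun setT dens2.
Proof. by apply/measurable_EFinP; apply: measurable_funB. Qed.

Let dens2_ge0 (A : set (plane R)) y :
  [set z.2 | z in A `&` @Ccurve R] y -> (0 <= dens2 y)%E.
Proof. by case=> -[a b] [_ [[_ /= /andP[_ ?]] _]] <-; rewrite lee_fin subr_ge0. Qed.

Let Rlim0 : Rlim (@set0 (plane R)) = 0%E.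
Proof. by rewrite /Rlim !set0I image_set0 !integral_set0 adde0. Qed.

Let Rlim_ge0 (A : set (plane R)) : (0 <= Rlim A)%E.
Proof.
apply: adde_ge0; apply: integral_ge0.
- by move=> z _; rewrite lee_fin expR_ge0.
- exact: dens2_ge0.
Qed.

Let Rlim_sigma_additive : semi_sigma_additive (@Rlim R).
Proof.
move=> F mF tF mUF.
have mG k : measurable (F k `&` @Cplus R).
  by apply: measurableI => //; exact: measurable_Cplus.
rewrite [X in _ --> X](_ : _ = \sum_(0 <= i <oo) Rlim (F i))%E.
  by apply: is_cvg_ereal_nneg_natsum => k _; exact: Rlim_ge0.
rewrite nneseriesD; last 2 first.
- by move=> i _ _; apply: integral_ge0 => z _; rewrite lee_fin expR_ge0.
- by move=> i _ _; apply: integral_ge0 => y; exact: dens2_ge0.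
rewrite /Rlim !setI_bigcupl image_bigcup; congr (_ + _)%E.
- apply: ge0_integral_bigcup => //.
  + exact: measurable_funTS.
  + exact: trivIset_setIr.
- apply: ge0_integral_bigcup => //.
  + by move=> k; exact: measurable_curve_snd.
  + exact: measurable_funTS.
  + by move=> y [k _]; exact: dens2_ge0.
  + move=> i j _ _ [y []]; rewrite !curve_snd => -[_ /= Fi] [_ /= Fj].
    by apply: tF => //; exists (phi y, y).
Qed.

HB.instance Definition _ := isMeasure.Build _ (plane R) R (@Rlim R)
  Rlim0 Rlim_ge0 Rlim_sigma_additive.

Lemma Rlim_full (A : set (plane R)) : @unit_square R `<=` A -> Rlim A = 1%E.
Proof.
move=> sA; rewrite /Rlim curve_snd.
have -> : A `&` @Cplus R = @Cplus R by apply/setIidr => z [/sA].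
have -> : `[0, 1] `&` (fun y : R => (phi y, y)) @^-1` A = `[0, 1]%classic.
  apply/setIidl => y /=; rewrite in_itv/= => y01.
  by apply: sA; split => //=; exact: phi_itv.
rewrite integral_mkcond fubini_tonelli2; last 2 first.
- apply: (proj1 (measurable_restrictT _ measurable_Cplus)).
  exact: measurable_funTS.
- by move=> z; apply: erestrict_ge0 => ? _; rewrite lee_fin expR_ge0.
have section_itv (y : R) : 0 <= y <= 1 ->
    [set x | Cplus (x, y)] = `[0, phi y[%classic.
  move=> y01; have /andP[_ phi1] := phi_itv y01.
  apply/seteqP; split => [x [[/= /andP[x0 _] _] /= xy]|x]; rewrite /= in_itv/=.
    by rewrite x0.
  move=> /andP[x0 xy]; split => //; split => //=.
  by rewrite x0/= (le_trans (ltW xy)).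
transitivity (\int[@lebesgue_measure R]_(y in `[0%R, 1%R]) y%:E +
    \int[@lebesgue_measure R]_(y in `[0%R, 1%R]) (1 - y)%:E)%E.
  congr (_ + _)%E; rewrite [RHS]integral_mkcond; apply: eq_integral => y _.
  rewrite /fubini_G /= [RHS]patchE mem_setE in_itv/=.
  case: ifPn => y01; last first.
    apply: integral0_eq => x _; rewrite patchE ifN//.
    by apply/negP; rewrite inE => -[[_ /= y01']]; rewrite y01' in y01.
  transitivity (\int[@lebesgue_measure R]_(x in `[0%R, phi y[)
      (expR (y - 1))%:E)%E.
    rewrite [RHS]integral_mkcond; apply: eq_integral => x _.
    by rewrite !patchE -(section_itv _ y01).
  rewrite integral_cst//= lebesgue_measure_itv/= lte_fin.
  have /andP[phi0 _] := phi_itv y01.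
  have -> : (if 0 < phi y then ((phi y)%:E - 0%:E)%E else 0%E) = (phi y)%:E.
    case: ifPn => [_|]; first by rewrite sube0.
    by rewrite -leNgt => p0; congr EFin; apply/le_anti; rewrite phi0 p0.
  rewrite -EFinM mulrCA -expRD (_ : y - 1 + (1 - y) = 0) ?expR0 ?mulr1//.
  by lra.
rewrite -ge0_integralD//; first last.
- exact: measurable_funTS.
- by move=> y; rewrite /= in_itv/= lee_fin subr_ge0 => /andP[].
- by move=> y; rewrite /= in_itv/= lee_fin => /andP[].
under eq_integral do rewrite -EFinD addrC subrK.
by rewrite integral_cst//= mul1e lebesgue_measure_itv/= lte_fin ltr01 sube0.
Qed.

HB.instance Definition _ := Measure_isProbability.Build _ _ _
  (@Rlim R) (Rlim_full (@subsetT _ _)).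

Lemma Rlim_unit_square : Rlim (@unit_square R) = 1%E.
Proof. exact: Rlim_full. Qed.

End Rlim_measure.

(* A function continuous on the compact set unit_square is bounded there, so
   the test functions are the bounded continuous functions on it. *)
Definition weak_cvg (R : realType)
    (P_ : nat -> probability (plane R) R) (P : probability (plane R) R) :=
  forall f : R * R -> R, {within @unit_square R, continuous f} ->
    (\int[P_ n]_(z in @unit_square R) (f z)%:E @[n --> \oo] -->
       \int[P]_(z in @unit_square R) (f z)%:E)%E.

(* Main.v *)
(** Put phi(t) = t e^{1-t}, and call a run low at level T if its first entry is
    at most T.  The low runs form a prefix of runsort(pi), so the mass of
    [0, x] x [0, y] is governed by the number of entries at most Y = yn lying in
    runs that are low at level T = tn.  Such an entry v ends exactly one window
    x <= T < x_1 < ... < x_k = v of consecutive entries, hence this number is a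
    sum over k of counts of windows of length k + 1.  A first and second moment
    computation (disjoint windows are almost independent) shows that each of
    these counts, divided by n, concentrates at min(t, y) d^k / k! with
    d = max(y - t, 0); summing over k gives min(t, y) e^d.  For y = 1 this is
    phi(t), so the low runs fill about the first phi(t) n positions, and the
    distribution function at (phi(t), y) converges to min(t, y) e^d, which is
    also the distribution function of the limit.  Weak convergence follows by
    uniform approximation of test functions by step functions on a grid. *)

Require Import Defs.
From HB Require Import structures.
From mathcomp Require Import all_boot all_order all_algebra all_fingroup.
From mathcomp Require Import all_classical all_reals all_analysis.
From mathcomp Require Import measurable_realfun zify ring lra.

Set Implicit Arguments.
Unset Strict Implicit.
Unset Printing Implicit Defensive.

Import Order.TTheory GRing.Theory Num.Theory numFieldNormedType.Exports.

Local Open Scope classical_set_scope.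
Local Open Scope ring_scope.

(** * Entries lying in runs with a small first entry *)

Section low_runs.
Local Open Scope nat_scope.

(* b tells whether the current run is low, and p is the previous entry. *)
Fixpoint low_entries (T : nat) (b : bool) (p : nat) (s : seq nat) : seq nat :=
  if s is x :: s' then
    let b' := (x <= T) || b && (p < x) in
    if b' then x :: low_entries T b' x s' else low_entries T b' x s'
  else [::].

(** An entry x <= T sets the flag even when it does not start a run: the first entry of its run is
    at most x, so that run is low anyway. *)
Lemma low_entries_runs T s :
  low_entries T false 0 s = flatten [seq r <- runs s | head 0 r <= T].
Proof.
(* Only the first run of [s] can continue the run that ends in [p], so only its status depends on
   [b] and [p]. *)
suff gen b p : low_entries T b p s =
    if runs s is r :: rs then
      (if (head 0 r <= T) || b && (p < head 0 r) then r else [::]) ++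
      flatten [seq r' <- rs | head 0 r' <= T]
    else [::].
  rewrite gen; case: (runs s) => //= r rs.
  by rewrite orbF; case: ifP.
elim: s b p => //= x s IH b p; rewrite IH; have := runs_neq0 s.
case: (runs s) => [_|[|y r] rs] //=; first by case: ifP.
move=> _; case: (ltnP x y) => xy /=.
  case: (leqP x T) => //= xT; first by rewrite orbT.
  by case: (b && (p < x)); rewrite ?andbT ?orbT ?orbF //= leqNgt (ltn_trans xT xy).
by case: ifP => _; rewrite ?andbF ?orbF /=; case: ifP.
Qed.

(** Sorting by first entries puts the low runs in front. It may change their order, so the prefix is
    described only up to permutation, which is enough for counting. *)
Lemma flatten_sort_low (T : nat) (rs : seq (seq nat)) :
  exists2 l, perm_eq l (flatten [seq r <- rs | head 0 r <= T]) &
    take (size l)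
      (flatten (sort (fun r r' => head 0 r <= head 0 r') rs)) = l.
Proof.
set le_head := fun r r' : seq nat => head 0 r <= head 0 r'.
have tr : transitive le_head by move=> b a c; exact: leq_trans.
have srt : sorted le_head (sort le_head rs).
  by apply: sort_sorted => a b; exact: leq_total.
have splitE s : sorted le_head s ->
    s = [seq r <- s | head 0 r <= T] ++ [seq r <- s | ~~ (head 0 r <= T)].
  elim: s => //= x s IH xs; have := IH (path_sorted xs).
  case: (boolP (head 0 x <= T)) => [_ {1}->//|xT _].
  have /allP hi := order_path_min tr xs.
  have hiT r : r \in s -> (head 0 r <= T) = false.
    move=> /hi xr; apply/negbTE; rewrite -ltnNge; rewrite -ltnNge in xT.
    exact: leq_trans xT (xr : head 0 x <= head 0 r).
  rewrite (eq_in_filter hiT) filter_pred0 /=; congr cons.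
  by rewrite (@eq_in_filter _ _ predT) ?filter_predT// => r /hiT ->.
exists (flatten [seq r <- sort le_head rs | head 0 r <= T]).
  by apply: perm_flatten; apply: perm_filter; rewrite perm_sort.
by rewrite [X in take _ (flatten X)](splitE _ srt) flatten_cat take_size_cat.
Qed.

Definition run_entries (T Y : nat) (s : seq nat) : nat :=
  count (leq^~ Y) (low_entries T false 0 s).

Lemma count_take_dist (p : pred nat) (l : seq nat) a b : a <= b ->
  count p (take a l) <= count p (take b l) <= count p (take a l) + (b - a).
Proof.
move=> ab; rewrite -(subnKC ab) takeD count_cat leq_addr leq_add2l /=.
by rewrite (leq_trans (count_size _ _))// addKn size_take_min geq_minl.
Qed.

(** Let [l] be the prefix of [runsort s] made of the low runs. As no entry exceeds [M],
    [run_entries T M s] is the length of [l], and passing from [l] to the prefix of length [a]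
    changes a count by at most the difference of the lengths. At most one of the two truncated
    subtractions is nonzero. *)
Lemma count_runsort_dist (s : seq nat) (T Y M a : nat) :
  all (leq^~ M) s ->
  count (leq^~ Y) (take a (runsort s)) <=
    run_entries T Y s + (a - run_entries T M s) /\
  run_entries T Y s <=
    count (leq^~ Y) (take a (runsort s)) + (run_entries T M s - a).
Proof.
move=> /allP sM; have [l] := flatten_sort_low T (runs s).
rewrite -low_entries_runs -/(runsort s) => lE lT.
have YE : run_entries T Y s = count (leq^~ Y) l by rewrite (seq.permP lE).
have ME : run_entries T M s = size l.
  rewrite (perm_size lE) /run_entries; apply/eqP.
  rewrite -all_count; apply/allP => v; rewrite -(perm_mem lE) => vl; apply: sM.
  by rewrite -(perm_mem (perm_runsort s)); apply: (@mem_take (size l)); rewrite lT.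
rewrite YE ME -{1 3}lT; case: (leqP a (size l)) => [al|/ltnW al].
  have /andP[h1 h2] := count_take_dist (leq^~ Y) (runsort s) al.
  by split => //; rewrite (leq_trans h1)// leq_addr.
have /andP[h1 h2] := count_take_dist (leq^~ Y) (runsort s) al.
by split => //; rewrite (leq_trans h1)// leq_addr.
Qed.

(* For l = x :: x_1 ... x_k this says x <= T < x_1 < ... < x_k <= Y, with x <= Y if
   k = 0; see good_windowE. *)
Definition good_window (T Y : nat) (l : seq nat) : bool :=
  if l is x :: l' then [&& x <= T, path ltn T l' & last x l' <= Y] else false.

Fixpoint asc_count (Y q : nat) (s : seq nat) : nat :=
  if s is x :: s' then if q < x then (x <= Y) + asc_count Y x s' else 0 else 0.

Fixpoint start_count (T Y : nat) (s : seq nat) : nat :=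
  if s is x :: s' then
    (if x <= T then (x <= Y) + asc_count Y T s' else 0) + start_count T Y s'
  else 0.

(** Each entry of a low run is charged to the last entry at most [T] that precedes or equals it in
    the run. From there on the run climbs above [T], which is what [asc_count Y T] follows. *)
Lemma run_entries_start T Y s : run_entries T Y s = start_count T Y s.
Proof.
(* In a low run the pending ascent must stay above both [p] and [T]: an entry at most [T] stops it
   and is itself a new start. *)
rewrite /run_entries; suff gen b p : count (leq^~ Y) (low_entries T b p s) =
    (if b then asc_count Y (maxn p T) s else 0) + start_count T Y s.
  by rewrite gen.
elim: s b p => [|x s IH] b p /=; first by case: b.
case: (leqP x T) => /= [xT|Tx].
  rewrite IH (maxn_idPr xT) ltnNge (leq_trans xT (leq_maxr _ _)) /=.
  by case: b; rewrite /= ?add0n ?addnA.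
rewrite add0n gtn_max Tx andbT; case: b => /=; last by rewrite IH.
by case: ifP => px /=; rewrite IH (maxn_idPl (ltnW Tx)) px ?addnA.
Qed.

Lemma asc_countE Y q s : asc_count Y q s =
  \sum_(k < size s) (path ltn q (take k.+1 s) && (last q (take k.+1 s) <= Y)).
Proof.
elim: s q => [|x s IH] q; first by rewrite big_ord0.
rewrite /= big_ord_recl /= take0 /= andbT; case: ltnP => qx /=.
  by rewrite IH; congr (_ + _); apply: eq_bigr.
by rewrite big1.
Qed.

Lemma start_countE T Y s : start_count T Y s =
  \sum_(a < size s) \sum_(k < size s | a + k < size s)
     good_window T Y (take k.+1 (drop a s)).
Proof.
elim: s => [|x s IH]; first by rewrite big_ord0.
rewrite [start_count _ _ _]/= -[size (x :: s)]/(size s).+1 big_ord_recl.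
congr (_ + _).
  rewrite (eq_bigl predT) => [|k]; last by rewrite add0n ltn_ord.
  rewrite drop0 big_ord_recl; case: (leqP x T) => xT; last first.
    by rewrite big1 => [|k _] /=; rewrite leqNgt xT ?take0.
  rewrite asc_countE /= xT take0 /=; congr (_ + _).
  by apply: eq_bigr; case: (s) => [[]|y s'].
rewrite IH; apply: eq_bigr => a _.
rewrite [RHS]big_mkcond big_ord_recr /= -big_mkcond /=.
rewrite ifF ?addn0; last by apply/negbTE; rewrite -leqNgt ltnS leq_addl.
by apply: eq_bigl => k; rewrite /= addSn ltnS.
Qed.

(** The windows are grouped by length, because concentration is proved for each length
    separately. *)
Lemma run_entriesE T Y s : run_entries T Y s =
  \sum_(k < size s) \sum_(a < size s - k)
     good_window T Y (take k.+1 (drop a s)).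
Proof.
rewrite run_entries_start start_countE (exchange_big_dep predT)//=.
apply: eq_bigr => k _.
rewrite (big_ord_widen_cond _ (fun=> true)
  (fun a => good_window T Y (take k.+1 (drop a s)) : nat) (leq_subr k _)).
by apply: eq_bigl => a /=; rewrite ltn_subRL addnC.
Qed.

End low_runs.

(** * Windows of a uniform random permutation *)

Section card_windows.
Local Open Scope set_scope.
Local Open Scope nat_scope.
Variables (I T : finType).

Let fiber (c : I -> T) (u : {ffun I -> T}) :=
  [set s : {perm T} | [ffun i => s (c i)] == u].

(** Multiplying by the inverse of one element [s0] embeds the fiber into the permutations that fix
    the image of [c] pointwise. *)
Let card_fiber_le (c : I -> T) (u : {ffun I -> T}) :
  injective c -> #|fiber c u| <= (#|T| - #|I|)`!.
Proof.
move=> c_inj; have [->|[s0]] := set_0Vmem (fiber c u); first by rewrite cards0.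
rewrite inE => /eqP s0u; pose C := [set c i | i : I].
have -> : #|T| - #|I| = #|~: C| by rewrite cardsCs finset.setCK card_imset.
rewrite -card_perm.
rewrite -(card_imset (fiber c u) (mulIg s0^-1%g)) subset_leq_card//.
apply/fintype.subsetP => _ /imsetP[s + ->]; rewrite !inE => /eqP su.
apply/fintype.subsetP => x; rewrite !inE; apply: contra => /imsetP[i _ ->].
rewrite permM; have /ffunP/(_ i) : [ffun i => s (c i)] = [ffun i => s0 (c i)].
  by rewrite su.
by rewrite !ffunE => ->; rewrite permK.
Qed.

(* The bounds of card_fiber_le already add up to the number of permutations, so
   none of them is strict. *)
Let card_fiber (c : I -> T) (u : {ffun I -> T}) : injective c -> injective u ->
  #|fiber c u| = (#|T| - #|I|)`!.
Proof.
move=> c_inj u_inj.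
have IT : #|I| <= #|T| by exact: leq_card c_inj.
pose inj := [set f : {ffun I -> T} | injectiveb f].
have := leqif_sum (fun f (_ : f \in inj) => leqif_eq (card_fiber_le f c_inj)).
rewrite sum_nat_const card_inj_ffuns ffact_fact//.
have -> : \sum_(f in inj) #|fiber c f| = (#|T|)`!.
  have <- : #|{perm T}| = (#|T|)`!.
    rewrite -[in RHS]cardsT -card_perm; apply: eq_card => p.
    by rewrite !inE; apply/esym/fintype.subsetP => x; rewrite !inE.
  under eq_bigr do rewrite -sum1_card big_mkcond.
  rewrite exchange_big /= -sum1_card [RHS]big_mkcond/=.
  apply: eq_bigr => s _; rewrite -big_mkcondr /= (big_pred1 [ffun i => s (c i)])//= => f.
  rewrite !inE [LHS]andbC eq_sym; case: eqP => //= ->.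
  by apply/injectiveP => i j; rewrite !ffunE => /perm_inj/c_inj.
move=> [_ /esym]; rewrite eqxx => /forall_inP/(_ u) H; apply/eqP/H.
by rewrite inE; apply/injectiveP.
Qed.

(** The permutations split into fibers over the elements of [G], all of the same size. *)
Lemma card_perm_window (c : I -> T) (G : {set {ffun I -> T}}) :
  injective c -> {in G, forall u : {ffun I -> T}, injective u} ->
  #|[set s : {perm T} | [ffun i => s (c i)] \in G]| = #|G| * (#|T| - #|I|)`!.
Proof.
move=> c_inj G_inj.
rewrite -sum_nat_const -(eq_bigr _ (fun u uG => card_fiber c_inj (G_inj u uG))).
under eq_bigr do rewrite -sum1_card big_mkcond.
rewrite exchange_big /= -sum1_card big_mkcond/=.
apply: eq_bigr => s _; rewrite inE -big_mkcondr /=.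
case: ifP => sG; last first.
  by rewrite big1// => f; rewrite inE => /andP[fG /eqP sf]; rewrite -sf sG in fG.
rewrite (big_pred1 [ffun i => s (c i)])//= => f.
by rewrite !inE andbC eq_sym; case: eqP => //= ->; rewrite sG.
Qed.

End card_windows.

(** * Counting the good value patterns of a window *)

Section good_windows.
Local Open Scope set_scope.
Local Open Scope nat_scope.
Variables (n T Y k : nat).

(** If [l] is nonempty, then T < Y and x <= Y is automatic, so the bound on x can be min(T, Y) in
    every case. The conditions on x and on [l] are then independent, whence the product in
    [card_good_set]. *)
Lemma good_windowE x l : good_window T Y (x :: l) =
  [&& x <= minn T Y, sorted ltn l & all (fun v => T < v <= Y) l].
Proof.
have last_le q r : path ltn q r -> (last q r <= Y) = all (leq^~ Y) (q :: r).
  elim: r q => [q _|y r IH q /= /andP[qy yr]] /=; first by rewrite andbT.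
  rewrite IH//=; case: (leqP y Y) => [yY|]; last by rewrite andbF.
  by rewrite (leq_trans (ltnW qy) yY).
rewrite /= leq_min (path_sortedE ltn_trans) -andbA; case: (leqP x T) => //= xT.
have -> : all (fun v => T < v <= Y) l = all (ltn T) l && all (leq^~ Y) l.
  by rewrite -all_predI.
case: l => [|y r] /=; first by rewrite andbT.
case: (boolP (path ltn y r)) => yr; last by rewrite !andbF.
rewrite last_le//= ?andbT; case: (ltnP T y) => //= Ty; last by rewrite andbF.
case: (all (ltn T) r); rewrite ?andbF//=.
case: (leqP y Y) => yY; rewrite ?andbF//.
by rewrite (leq_trans (leq_trans xT (ltnW Ty)) yY).
Qed.

Definition good_set : {set {ffun 'I_k.+1 -> 'I_n.+1}} :=
  [set u : {ffun 'I_k.+1 -> 'I_n.+1} |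
    good_window T Y [seq (nat_of_ord (u i)).+1 | i <- enum 'I_k.+1]].

Lemma good_set_inj (u : {ffun 'I_k.+1 -> 'I_n.+1}) :
  u \in good_set -> injective u.
Proof.
rewrite inE; set f := fun i => _; move=> uG.
have /injectiveP f_inj : injectiveb f.
  rewrite /injectiveb /dinjectiveb; move: uG; case: map => // x l /and3P[xT Tl _].
  apply: (sorted_uniq ltn_trans ltnn) => /=.
  by case: l Tl => //= y l /andP[Ty ->]; rewrite (leq_ltn_trans xT Ty).
by move=> i j uij; apply: f_inj; rewrite /f uij.
Qed.

(** A good pattern amounts to a first value among the min(T, Y) smallest and a k-subset of the
    values in ]T, Y], listed in increasing order. *)
Lemma card_good_set : T <= n.+1 -> Y <= n.+1 ->
  #|good_set| = minn T Y * 'C(Y - T, k).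
Proof.
move=> Tn Yn; rewrite -card_ltn_sorted_tuples -[minn T Y]card_ord -cardsT -cardsX.
(* Values are zero-based here: the first one is below min(T, Y), and the subset is shifted by
   [T]. *)
pose F (p : 'I_(minn T Y) * k.-tuple 'I_(Y - T)) : {ffun 'I_k.+1 -> 'I_n.+1} :=
  [ffun i => if unlift ord0 i is Some j then inord (T + tnth p.2 j)
             else inord p.1].
have F0 p : F p ord0 = p.1 :> nat.
  by rewrite ffunE unlift_none inordK// (leq_trans (ltn_ord p.1))// geq_min Tn.
have FS p j : F p (lift ord0 j) = T + tnth p.2 j :> nat.
  rewrite ffunE liftK inordK//; have := ltn_ord (tnth p.2 j); lia.
have F_inj : injective F.
  move=> [a t] [a' t'] /ffunP FE; congr pair.
    by apply: val_inj; have := congr1 val (FE ord0); rewrite /= !F0.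
  apply: eq_from_tnth => j; apply: val_inj.
  have := congr1 val (FE (lift ord0 j)); rewrite /= !FS => /=.
  exact: addnI.
rewrite -(card_imset _ F_inj); apply: eq_card => u.
rewrite inE enum_ordSl map_cons -map_comp good_windowE.
apply/and3P/imsetP => [[u0 us uT]|[[a t]]].
  have uTj j : T <= u (lift ord0 j) < Y.
    by have /= := allP uT _ (map_f _ (mem_enum _ j)); rewrite ltnS.
  have ulj j : u (lift ord0 j) - T < Y - T by have := uTj j; lia.
  exists (Ordinal u0, [tuple Ordinal (ulj j) | j < k]).
    rewrite !inE /= -map_comp.
    move: us; rewrite !sorted_map; apply: sub_in_sorted => // i j _ _ /=.
    by rewrite ltn_sub2rE//; case/andP: (uTj i).
  apply/ffunP => i; apply: val_inj; case: (unliftP ord0 i) => [j|] ->.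
    by rewrite /= FS tnth_mktuple /= subnKC//; case/andP: (uTj j).
  by rewrite /= F0.
rewrite inE => /andP[_]; rewrite inE /= => t_sorted ->.
have -> : [seq (val (F (a, t) (lift ord0 j))).+1 | j <- enum 'I_k] =
    [seq (T + i).+1 | i <- [seq val i | i <- t]].
  rewrite -[in RHS](map_tnth_enum t) -!map_comp; apply: eq_map => j /=.
  by rewrite FS.
split; first by rewrite F0 /=.
  rewrite sorted_map; apply: sub_sorted t_sorted => i j /=.
  by rewrite ltnS ltn_add2l.
apply/allP => _ /mapP[_ /mapP[i _ ->] ->] /=; have := ltn_ord i; lia.
Qed.

End good_windows.

(** * First and second moments of the number of good windows *)

Section window_moments.
Local Open Scope set_scope.
Local Open Scope nat_scope.
Variables (n T Y k : nat).

Definition good_at (s : {perm 'I_n.+1}) (a : nat) : bool :=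
  good_window T Y (take k.+1 (drop a (word s))).

Definition window_count (s : {perm 'I_n.+1}) : nat :=
  \sum_(a < n.+1 - k) good_at s a.

Let pos (a : nat) (i : 'I_k.+1) : 'I_n.+1 := inord (a + i).

Let posE a i : a + k < n.+1 -> pos a i = a + i :> nat.
Proof. by move=> ak; rewrite inordK//; have := ltn_ord i; lia. Qed.

Let pos_inj a : a + k < n.+1 -> injective (pos a).
Proof.
move=> ak i j /(congr1 val); rewrite /= !posE// => /addnI.
exact: val_inj.
Qed.

Lemma good_atE (s : {perm 'I_n.+1}) a : a + k < n.+1 ->
  good_at s a = ([ffun i => s (pos a i)] \in good_set n T Y k).
Proof.
move=> ak; rewrite inE /good_at; congr good_window.
have sz : k.+1 <= size (drop a (word s)) by rewrite size_drop size_word; lia.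
apply: (@eq_from_nth _ 0); first by rewrite size_takel// size_map size_enum_ord.
move=> i; rewrite size_takel// => ik.
have ai : a + i < n.+1 by rewrite (leq_trans _ ak)// !ltnS leq_add2l -ltnS.
rewrite nth_take// nth_drop.
rewrite (nth_map ord0 0); last by rewrite size_enum_ord.
rewrite (nth_map ord0 0); last by rewrite size_enum_ord.
congr _.+1; rewrite ffunE; congr (nat_of_ord (s _)).
apply: ord_inj; rewrite posE// !nth_enum_ord//.
Qed.

Lemma card_good_at a : a + k < n.+1 ->
  #|[set s : {perm 'I_n.+1} | good_at s a]| =
    #|good_set n T Y k| * (n.+1 - k.+1)`!.
Proof.
move=> ak; have := card_perm_window (pos_inj ak) (@good_set_inj n T Y k).
rewrite !card_ord => <-.
by apply: eq_card => s; rewrite !inE good_atE// inE.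
Qed.

(** Two disjoint windows are read by one injection of the sum of their index sets. This is only an
    upper bound, since [G] is embedded into all pairs of good patterns, including those that share a
    value. *)
Lemma card_good_at2 a b : a + k < b -> b + k < n.+1 ->
  #|[set s : {perm 'I_n.+1} | good_at s a && good_at s b]| <=
    #|good_set n T Y k| ^ 2 * (n.+1 - (k.+1 + k.+1))`!.
Proof.
move=> akb bk; have ak : a + k < n.+1 by lia.
pose c (i : 'I_k.+1 + 'I_k.+1) :=
  match i with inl i => pos a i | inr i => pos b i end.
have c_inj : injective c.
  move=> [i|i] [j|j] /= ij.
  - by rewrite (pos_inj ak ij).
  - by move/(congr1 val): ij; rewrite /= !posE//; have := ltn_ord i; lia.
  - by move/(congr1 val): ij; rewrite /= !posE//; have := ltn_ord j; lia.
  - by rewrite (pos_inj bk ij).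
pose l (u : {ffun 'I_k.+1 + 'I_k.+1 -> 'I_n.+1}) := [ffun i => u (inl i)].
pose r (u : {ffun 'I_k.+1 + 'I_k.+1 -> 'I_n.+1}) := [ffun i => u (inr i)].
pose G := [set u : {ffun 'I_k.+1 + 'I_k.+1 -> 'I_n.+1} |
  [&& injectiveb u, l u \in good_set n T Y k & r u \in good_set n T Y k]].
have lr_inj : injective (fun u => (l u, r u)).
  move=> u v [/ffunP lE /ffunP rE]; apply/ffunP => -[i|i].
    by have := lE i; rewrite !ffunE.
  by have := rE i; rewrite !ffunE.
have -> : #|[set s : {perm 'I_n.+1} | good_at s a && good_at s b]| =
    #|[set s : {perm 'I_n.+1} | [ffun i => s (c i)] \in G]|.
  apply: eq_card => s; rewrite 2!inE [RHS]inE (good_atE _ ak) (good_atE _ bk).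
  have /injectiveP -> : injective [ffun i => s (c i)].
    by move=> i j; rewrite !ffunE => /perm_inj/c_inj.
  have -> : l [ffun i => s (c i)] = [ffun i => s (pos a i)].
    by apply/ffunP => i; rewrite !ffunE.
  have -> // : r [ffun i => s (c i)] = [ffun i => s (pos b i)].
  by apply/ffunP => i; rewrite !ffunE.
rewrite card_perm_window//; last first.
  by move=> u; rewrite inE => /and3P[/injectiveP u_inj _ _].
rewrite card_sum !card_ord leq_mul2r; apply/orP; right.
rewrite -(card_imset G lr_inj) -mulnn -cardsX subset_leq_card//.
apply/fintype.subsetP => _ /imsetP[u + ->].
by rewrite !inE => /and3P[_ -> ->].
Qed.

Lemma sum_window_count : k < n.+1 ->
  \sum_(s : {perm 'I_n.+1}) window_count s =
    (n.+1 - k) * (#|good_set n T Y k| * (n.+1 - k.+1)`!).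
Proof.
move=> kn; rewrite exchange_big /= -[X in X * _]card_ord -sum_nat_const.
apply: eq_bigr => a _.
have ak : a + k < n.+1 by have := ltn_ord a; lia.
rewrite -(card_good_at ak).
by rewrite -sum1_card [RHS]big_mkcond; apply: eq_bigr => s _; rewrite inE; case: good_at.
Qed.

Let card_close (a L : nat) :
  \sum_(b < L) ((b <= a + k) && (a <= b + k)) <= (2 * k).+1.
Proof.
pose p b := (b <= a + k) && (a <= b + k).
rewrite (eq_bigr (fun b : 'I_L => if p b then 1 else 0)); last first.
  by move=> b _; rewrite /p; case: andb.
rewrite -big_mkcond -(big_mkord p (fun=> 1)) sum1_count -size_filter.
rewrite -(size_iota (a - k) (2 * k).+1) uniq_leq_size ?filter_uniq ?iota_uniq//.
by move=> b; rewrite mem_filter mem_iota /p => /andP[]; lia.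
Qed.

(* The first term bounds the pairs of disjoint windows; a window meets at most
   2k + 1 others, counting itself. *)
Lemma sum_window_count_sq : k < n.+1 ->
  \sum_(s : {perm 'I_n.+1}) window_count s ^ 2 <=
    (n.+1 - k) ^ 2 *
      (#|good_set n T Y k| ^ 2 * (n.+1 - (k.+1 + k.+1))`!) +
    (n.+1 - k) * (2 * k).+1 * (n.+1)`!.
Proof.
move=> kn; set L := n.+1 - k; set C := _ ^ 2 * _`!.
have pairE s : window_count s ^ 2 =
    \sum_(a < L) \sum_(b < L) (good_at s a && good_at s b).
  rewrite -mulnn big_distrl; apply: eq_bigr => a _ /=.
  by rewrite big_distrr; apply: eq_bigr => b _ /=; rewrite mulnb.
under eq_bigr do rewrite pairE.
rewrite exchange_big /=; under eq_bigr do rewrite exchange_big /=.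
(* Windows that overlap get the trivial bound by the number of all permutations; the boolean factor
   vanishes for disjoint ones. *)
have pair_le (a b : 'I_L) :
    \sum_(s : {perm 'I_n.+1}) (good_at s a && good_at s b) <=
      C + ((b <= a + k) && (a <= b + k)) * (n.+1)`!.
  rewrite (eq_bigr (fun s => if s \in
    [set s : {perm 'I_n.+1} | good_at s a && good_at s b] then 1 else 0));
    last by move=> s _; rewrite inE; case: andb.
  rewrite -big_mkcond sum1_card.
  have Lk (i : 'I_L) : i + k < n.+1 by rewrite addnC -ltn_subRL ltn_ord.
  case: (leqP b (a + k)) => [ba|ab]; last first.
    by rewrite (leq_trans (card_good_at2 ab (Lk b)))// leq_addr.
  case: (leqP a (b + k)) => [_|ba'] /=; last first.
    rewrite (eq_card (B := [set s : {perm 'I_n.+1} | good_at s b && good_at s a])).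
      by rewrite (leq_trans (card_good_at2 ba' (Lk a)))// leq_addr.
    by move=> s; rewrite !inE andbC.
  rewrite mul1n (leq_trans _ (leq_addl _ _))// -card_Sn max_card//.
apply: (@leq_trans (\sum_(a < L) \sum_(b < L)
    (C + ((b <= a + k) && (a <= b + k)) * (n.+1)`!))).
  by apply: leq_sum => a _; apply: leq_sum => b _; exact: pair_le.
under eq_bigr do rewrite big_split /=.
rewrite big_split /= leq_add//.
  by rewrite !sum_nat_const !card_ord mulnA mulnn.
under eq_bigr do rewrite -big_distrl /=.
rewrite -big_distrl leq_mul2r; apply/orP; right.
rewrite -[X in X * _](card_ord L) -sum_nat_const leq_sum// => a _.
exact: card_close.
Qed.

End window_moments.

(** * Concentration of the number of entries in low runs *)

Section perm_mean.
Context {R : realType} {n : nat}.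
Implicit Types X Y : {perm 'I_n.+1} -> R.

Definition perm_mean X : R := (\sum_s X s) / (n.+1)`!%:R.

Lemma perm_mean_cst (c : R) : perm_mean (fun=> c) = c.
Proof.
by rewrite /perm_mean sumr_const card_Sn -[c *+ _]mulr_natr mulfK.
Qed.

Lemma perm_meanD X Y :
  perm_mean (fun s => X s + Y s) = perm_mean X + perm_mean Y.
Proof. by rewrite /perm_mean big_split mulrDl. Qed.

Lemma perm_meanZ c X : perm_mean (fun s => c * X s) = c * perm_mean X.
Proof. by rewrite /perm_mean -mulr_sumr mulrA. Qed.

Lemma perm_mean_sum (m : nat) (X : nat -> {perm 'I_n.+1} -> R) (l : nat) :
  perm_mean (fun s => \sum_(l <= k < m) X k s) =
    \sum_(l <= k < m) perm_mean (X k).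
Proof. by rewrite /perm_mean exchange_big /= mulr_suml. Qed.

Lemma ler_perm_mean X Y : (forall s, X s <= Y s) -> perm_mean X <= perm_mean Y.
Proof.
by move=> XY; rewrite /perm_mean ler_wpM2r ?invr_ge0 ?ler0n// ler_sum.
Qed.

Lemma perm_meanN X : perm_mean (fun s => - X s) = - perm_mean X.
Proof. by rewrite /perm_mean sumrN mulNr. Qed.

Lemma ler_norm_perm_mean X : `|perm_mean X| <= perm_mean (fun s => `|X s|).
Proof.
rewrite ler_norml lerNl -perm_meanN; apply/andP; split; apply: ler_perm_mean => s.
  by rewrite -normrN ler_norm.
exact: ler_norm.
Qed.

(** Pointwise this is (e - |X|)^2 >= 0. It passes from second moments to first absolute moments
    without square roots. *)
Lemma perm_mean_norm_le X (e : R) : 0 < e ->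
  perm_mean (fun s => `|X s|) <= e / 2 + perm_mean (fun s => X s ^+ 2) / (2 * e).
Proof.
move=> e0; rewrite [X in _ <= _ + X]mulrC -perm_meanZ -(perm_mean_cst (e / 2)).
rewrite -perm_meanD; apply: ler_perm_mean => s.
rewrite -(real_normK (num_real (X s))); set a := `|X s|.
have -> : e / 2 + (2 * e)^-1 * a ^+ 2 = a + (e - a) ^+ 2 / (2 * e).
  by field; rewrite gt_eqF.
by rewrite lerDl divr_ge0 ?sqr_ge0// mulr_ge0// ltW.
Qed.

End perm_mean.

(** * Limits of integer sequences divided by n + 1 *)

Section ratio_limits.
Context {R : realType}.
Local Notation "u /n" := (fun n : nat => (u n)%:R / n.+1%:R : R)
  (at level 30, only parsing).

Lemma cvg_cst_ratio (k : nat) : (fun=> k) /n @ \oo --> (0 : R).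
Proof.
rewrite -(mulr0 k%:R); apply: cvgM; first exact: cvg_cst.
exact: cvg_harmonic.
Qed.

(** Truncated subtraction is the positive part of the real one, and max(x, 0) = (x + |x|) / 2 is
    continuous. *)
Lemma cvg_subn_ratio (u v : nat -> nat) (a b : R) :
  u /n @ \oo --> a -> v /n @ \oo --> b ->
  (fun n => (u n - v n)%N) /n @ \oo --> Num.max (a - b) 0.
Proof.
move=> ua vb.
have natB (m p : nat) : (m - p)%:R = Num.max (m%:R - p%:R) 0 :> R.
  have [mp|/ltnW pm] := leqP m p.
    rewrite (eqP mp); apply/esym/max_idPr; by rewrite subr_le0 ler_nat.
  by rewrite natrB//; apply/esym/max_idPl; rewrite subr_ge0 ler_nat.
have -> : (fun n => (u n - v n)%N) /n =
    (fun n => ((u n)%:R / n.+1%:R - (v n)%:R / n.+1%:R +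
      `|(u n)%:R / n.+1%:R - (v n)%:R / n.+1%:R|) / 2).
  apply/funext => n; rewrite natB -mulrBl.
  rewrite maxr_absE subr0 addr0 normrM.
  by rewrite [`|_^-1|]ger0_norm ?invr_ge0// -mulrDl mulrAC.
rewrite maxr_absE subr0 addr0; apply: cvgM; last exact: cvg_cst.
by apply: cvgD; [exact: cvgB|apply: cvg_norm; exact: cvgB].
Qed.

(** Each of the [k] factors of the falling factorial has ratio d in the limit; as d >= 0, truncating
    the factors at zero does no harm. *)
Lemma cvg_ffact_ratio (u : nat -> nat) (d : R) (k : nat) : 0 <= d ->
  u /n @ \oo --> d ->
  (fun n => (u n ^_ k)%:R / n.+1%:R ^+ k : R) @ \oo --> d ^+ k.
Proof.
move=> d0 ud; elim: k => [|k IH].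
  rewrite expr0 (_ : (fun _ => _) = fun=> 1); first exact: cvg_cst.
  by apply/funext => n; rewrite ffactn0 expr0 divr1.
have := cvg_subn_ratio ud (cvg_cst_ratio k); rewrite subr0 (max_idPl d0) => h.
rewrite exprSr (_ : (fun _ => _) = fun n => (u n ^_ k)%:R / n.+1%:R ^+ k *
  ((u n - k)%:R / n.+1%:R)); first exact: cvgM.
by apply/funext => n; rewrite ffactnSr natrM exprSr invfM mulrACA.
Qed.

Lemma cvg_id_ratio : (fun n => n.+1) /n @ \oo --> (1 : R).
Proof.
rewrite (_ : (fun _ => _) = fun=> 1); first exact: cvg_cst.
by apply/funext => n; rewrite divff.
Qed.

End ratio_limits.

(** For T = 0 the left side vanishes; otherwise Y - T <= N - 1, which fits the last [k] factors on
    the right. This bounds the probability that a window is good by 1 / k!. *)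
Lemma minn_ffact_le (N T Y k : nat) : (T <= N)%N -> (Y <= N)%N ->
  (minn T Y * (Y - T) ^_ k <= N ^_ k.+1)%N.
Proof.
have ffact_mono a b : (a <= b)%N -> (a ^_ k <= b ^_ k)%N.
  by move=> ab; rewrite !ffact_prod leq_prod// => i _; rewrite leq_sub2r.
case: T => [|T] TN YN; first by rewrite min0n.
rewrite ffactnS leq_mul//; first by rewrite (leq_trans (geq_minl _ _)).
by apply: ffact_mono; lia.
Qed.

(** * Convergence in mean, first for one window length, then for the sum *)

Section window_count_limits.
Context {R : realType}.
Variables (T Y : nat -> nat) (t y : R).
Hypotheses (TN : forall n, (T n <= n.+1)%N) (YN : forall n, (Y n <= n.+1)%N).
Hypotheses (Tt : ((T n)%:R / n.+1%:R : R) @[n --> \oo] --> t)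
           (Yy : ((Y n)%:R / n.+1%:R : R) @[n --> \oo] --> y).

Let d : R := Num.max (y - t) 0.
Let d_ge0 : 0 <= d. Proof. by rewrite le_max lexx orbT. Qed.
Let Z n k (s : {perm 'I_n.+1}) : R := (window_count (T n) (Y n) k s)%:R.
Let G n k : R := #|good_set n (T n) (Y n) k|%:R.
(* y - d is the minimum of t and y. *)
Let z k : R := (y - d) * (d ^+ k / k`!%:R).

Let ffact_neq0 n k : (k <= n)%N -> (n ^_ k)%:R != 0 :> R.
Proof. by move=> kn; rewrite pnatr_eq0 -lt0n ffact_gt0. Qed.

Let fact_neq0 n : n`!%:R != 0 :> R.
Proof. by rewrite pnatr_eq0 -lt0n fact_gt0. Qed.

(** The minimum of T and Y is written as Y - (Y - T) with truncated inner subtraction, a form to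
    which the limits of ratios apply. *)
Let GE n k : G n k = ((Y n)%:R - (Y n - T n)%:R) * (((Y n - T n) ^_ k)%:R / k`!%:R).
Proof.
rewrite /G card_good_set// natrM; congr (_ * _).
  by rewrite -natrB ?leq_subr// minnC minnE.
by rewrite -bin_ffact natrM mulfK.
Qed.

Let fact_ratio n k : (k <= n)%N -> ((n - k)`!%:R / n`!%:R : R) = (n ^_ k)%:R^-1.
Proof.
by move=> kn; rewrite -(ffact_fact kn) natrM invfM mulrCA divff ?mulr1.
Qed.

Let mean_Z n k : (k <= n)%N ->
  perm_mean (@Z n k) = (n.+1 - k)%:R * G n k / (n.+1 ^_ k.+1)%:R.
Proof.
move=> kn; rewrite /perm_mean /Z -natr_sum sum_window_count//.
by rewrite (natrM _ (_ - _)) (natrM _ #|_|) -!mulrA fact_ratio.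
Qed.

Let mean_Z2 n k : (k.+1 + k.+1 <= n.+1)%N ->
  perm_mean (fun s : {perm 'I_n.+1} => Z k s ^+ 2) <=
    (n.+1 - k)%:R ^+ 2 * (G n k ^+ 2 / (n.+1 ^_ (k.+1 + k.+1))%:R) +
    (n.+1 - k)%:R * (2 * k).+1%:R.
Proof.
move=> kn; rewrite /perm_mean ler_pdivrMr ?ltr0n ?fact_gt0//.
rewrite mulrDl -fact_ratio//.
have -> : (n.+1 - k)%:R ^+ 2 * (G n k ^+ 2 * ((n.+1 - (k.+1 + k.+1))`!%:R / (n.+1)`!%:R))
    * (n.+1)`!%:R = (n.+1 - k)%:R ^+ 2 * (G n k ^+ 2 * (n.+1 - (k.+1 + k.+1))`!%:R).
  by field; exact: fact_neq0.
rewrite /Z /G -!natrX -!natrM -natrD.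
under eq_bigr do rewrite -natrX.
by rewrite -natr_sum ler_nat sum_window_count_sq//; lia.
Qed.

Let cvg_G k : (G n k / n.+1%:R ^+ k.+1) @[n --> \oo] --> z k.
Proof.
have Dd : ((Y n - T n)%:R / n.+1%:R : R) @[n --> \oo] --> d.
  exact: cvg_subn_ratio.
rewrite (_ : (fun _ => _) = fun n => ((Y n)%:R / n.+1%:R - (Y n - T n)%:R / n.+1%:R) *
    ((((Y n - T n) ^_ k)%:R / n.+1%:R ^+ k) / k`!%:R)).
  apply: cvgM; first exact: cvgB.
  by apply: cvgM; [exact: cvg_ffact_ratio|exact: cvg_cst].
apply/funext => n; rewrite GE -mulrBl exprS invfM; ring.
Qed.

Let cvg_ffact k : ((n.+1 ^_ k)%:R / n.+1%:R ^+ k : R) @[n --> \oo] --> (1 : R).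
Proof.
have := @cvg_ffact_ratio R (fun n => n.+1) 1 k ler01 cvg_id_ratio.
by rewrite expr1n.
Qed.

Let cvg_L k : ((n.+1 - k)%:R / n.+1%:R : R) @[n --> \oo] --> (1 : R).
Proof.
have := cvg_subn_ratio (@cvg_id_ratio R) (cvg_cst_ratio k).
by rewrite subr0 (max_idPl ler01).
Qed.

(** After expanding the square, [B n] bounds the mean. In the limit the disjoint pairs give z^2, the
    overlapping pairs 0, the cross term -2 z^2 and the constant z^2, so the total is 0. *)
Let cvg_mean_sq k :
  perm_mean (fun s : {perm 'I_n.+1} => (Z k s / n.+1%:R - z k) ^+ 2) @[n --> \oo]
    --> (0 : R).
Proof.
pose A (n : nat) : R := (n.+1 - k)%:R / n.+1%:R.
pose g (n : nat) : R := G n k / n.+1%:R ^+ k.+1.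
pose F m (n : nat) : R := (n.+1 ^_ m)%:R / n.+1%:R ^+ m.
pose B (n : nat) : R := A n ^+ 2 * (g n ^+ 2 / F (k.+1 + k.+1)%N n) +
  A n * ((2 * k).+1%:R / n.+1%:R) - 2 * z k * (A n * (g n / F k.+1 n)) + z k ^+ 2.
have cF m : F m n @[n --> \oo] --> (1 : R) by exact: cvg_ffact.
have cA : A n @[n --> \oo] --> (1 : R) by exact: cvg_L.
have cg : g n @[n --> \oo] --> z k by exact: cvg_G.
have cFV m : (F m n)^-1 @[n --> \oo] --> (1 : R).
  by rewrite -invr1; apply: cvgV.
have cB : B n @[n --> \oo] --> (0 : R).
  have -> : 0 = 1 ^+ 2 * (z k ^+ 2 * 1) + 1 * 0 - 2 * z k * (1 * (z k * 1)) + z k ^+ 2.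
    by ring.
  apply: cvgD; last exact: cvg_cst.
  apply: cvgB.
    apply: cvgD.
      apply: cvgM; first by rewrite expr2; apply: cvgM.
      by apply: cvgM => //; rewrite expr2; apply: cvgM.
    by apply: cvgM => //; exact: cvg_cst_ratio.
  by apply: cvgM; [exact: cvg_cst|apply: cvgM => //; apply: cvgM].
apply: (squeeze_cvgr _ (cvg_cst 0) cB).
near=> n.
have kn : (k.+1 + k.+1 <= n.+1)%N by rewrite ltnW// ltnS; near: n; exact: nbhs_infty_ge.
apply/andP; split.
  by rewrite -[X in X <= _](@perm_mean_cst R n) ler_perm_mean// => s; rewrite sqr_ge0.
have n0 : n.+1%:R != 0 :> R by rewrite pnatr_eq0.
have -> : (fun s => (Z k s / n.+1%:R - z k) ^+ 2) = (fun s : {perm 'I_n.+1} =>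
    n.+1%:R^-2 * Z k s ^+ 2 + (- (2 * z k / n.+1%:R) * Z k s + z k ^+ 2)).
  by apply/funext => s; field.
rewrite perm_meanD perm_meanD !perm_meanZ perm_mean_cst mean_Z; last by lia.
rewrite addrA lerD2r /B.
apply: lerD.
  apply: (@le_trans _ _ (n.+1%:R^-2 *
    ((n.+1 - k)%:R ^+ 2 * (G n k ^+ 2 / (n.+1 ^_ (k.+1 + k.+1))%:R) +
    (n.+1 - k)%:R * (2 * k).+1%:R))).
    by rewrite ler_wpM2l ?invr_ge0 ?exprn_ge0// mean_Z2.
  rewrite le_eqVlt; apply/orP; left; apply/eqP; rewrite /A /g /F exprD.
  have := ffact_neq0 kn; move: (n.+1%:R) n0 => N N0 F0.
  by field; rewrite N0 expf_neq0.
rewrite le_eqVlt; apply/orP; left; apply/eqP; rewrite /A /g /F [n.+1%:R ^+ k.+1]exprS.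
have kn' : (k.+1 <= n.+1)%N by lia.
have := ffact_neq0 kn'; move: (n.+1%:R) n0 => N N0 F0.
by field; rewrite N0 expf_neq0.
Unshelve. all: by end_near. Qed.

(** Once the second moment is at most e^2, [perm_mean_norm_le] gives the bound e / 2 + e / 2. *)
Let cvg_mean_abs k :
  perm_mean (fun s : {perm 'I_n.+1} => `|Z k s / n.+1%:R - z k|) @[n --> \oo]
    --> (0 : R).
Proof.
apply/cvgr0Pnorm_le => e e0; have e2 : 0 < e ^+ 2 by rewrite exprn_gt0.
have := cvg_mean_sq k => /cvgr0Pnorm_le/(_ _ e2); apply: filterS => n h.
rewrite ger0_norm; last first.
  by rewrite -[X in X <= _](@perm_mean_cst R n) ler_perm_mean.
apply: le_trans (perm_mean_norm_le _ e0) _.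
rewrite [leRHS](_ : e = e / 2 + e ^+ 2 / (2 * e)); last first.
  by field; rewrite gt_eqF.
have e20 : 0 <= (2 * e)^-1 by rewrite invr_ge0 mulr_ge0// ltW.
by rewrite lerD2l ler_wpM2r// (le_trans (ler_norm _) h).
Qed.

(** There are at most n + 1 windows, each good with probability at most 1 / k!. The bound is
    summable and independent of [n], which allows the sum over [k] to be cut off. *)
Let mean_tail n k : (k <= n)%N ->
  perm_mean (fun s : {perm 'I_n.+1} => Z k s / n.+1%:R) <= (k`!%:R)^-1.
Proof.
move=> kn; have -> : (fun s : {perm 'I_n.+1} => Z k s / n.+1%:R) =
    (fun s : {perm 'I_n.+1} => n.+1%:R^-1 * Z k s).
  by apply/funext => s; rewrite mulrC.
have h : G n k * k`!%:R <= (n.+1 ^_ k.+1)%:R.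
  rewrite /G card_good_set// -natrM ler_nat -mulnA bin_ffact.
  exact: minn_ffact_le.
have F0 : 0 < (n.+1 ^_ k.+1)%:R :> R by rewrite ltr0n ffact_gt0.
have K0 : 0 < k`!%:R :> R by rewrite ltr0n fact_gt0.
rewrite perm_meanZ mean_Z// mulrA mulrA ler_pdivrMr// -ler_pdivrMl ?invr_gt0//.
rewrite invrK; apply: le_trans h; rewrite mulrC ler_wpM2r// -[leRHS]mul1r.
rewrite ler_wpM2r ?ler0n// mulrC ler_pdivrMr ?ltr0n// mul1r ler_nat.
exact: leq_subr.
Qed.

(** The sum over window lengths is cut at a fixed [K]. The lengths below [K] converge one by one,
    the longer ones are small in mean by [mean_tail], and the [z k] sum to (y - d) e^d by the
    exponential series. *)
Lemma run_entries_mean_abs :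
  perm_mean (fun s : {perm 'I_n.+1} =>
    `|(run_entries (T n) (Y n) (word s))%:R / n.+1%:R - (y - d) * expR d|)
    @[n --> \oo] --> (0 : R).
Proof.
pose h := (y - d) * expR d.
have ze : series z @ \oo --> h.
  rewrite (_ : series z = fun m => (y - d) * series (exp_coeff d) m); last first.
    by apply/funext => m; rewrite /series /= mulr_sumr.
  by apply: cvgM; [exact: cvg_cst|exact: is_cvg_series_exp_coeff].
have inv_fact : series (exp_coeff (1 : R)) =
    fun m => \sum_(0 <= k < m) (k`!%:R)^-1.
  by apply/funext => m; apply: eq_bigr => k _; rewrite /exp_coeff /= expr1n mul1r.
have e1 : series (exp_coeff (1 : R)) @ \oo --> expR (1 : R).
  exact: is_cvg_series_exp_coeff.
have e1_le m : \sum_(0 <= k < m) (k`!%:R)^-1 <= expR (1 : R).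
  have mono : {homo series (exp_coeff (1 : R)) : a b / (a <= b)%N >-> a <= b}.
    move=> a b ab; rewrite inv_fact (big_cat_nat _ ab)//= lerDl.
    by rewrite sumr_ge0// => i _; rewrite invr_ge0.
  rewrite -(congr1 (@^~ m) inv_fact).
  exact: nondecreasing_cvgn_le mono (is_cvg_series_exp_coeff (1 : R)) m.
apply/cvgr0Pnorm_le => e e0; have e3 : 0 < e / 3 by rewrite divr_gt0.
(* [K] is chosen before [n]. The second condition concerns the series of 1 / k!, whose tail
   dominates the mean number of longer windows for every [n]. *)
have [K [hK eK]] : exists K, `|h - series z K| <= e / 3 /\
    expR 1 - \sum_(0 <= k < K) (k`!%:R)^-1 <= e / 3.
  have h1 : \forall K \near \oo, `|h - series z K| <= e / 3.
    by move/cvgrPdist_le : ze; exact.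
  have h2 : \forall K \near \oo, `|expR 1 - series (exp_coeff (1 : R)) K| <= e / 3.
    by move/cvgrPdist_le : e1; exact.
  have [K [k1 k2]] := filter_ex (filterI h1 h2).
  by exists K; split=> //; rewrite (le_trans (ler_norm _))// -(congr1 (@^~ K) inv_fact).
have sum_cvg : (\sum_(0 <= k < K) perm_mean (fun s : {perm 'I_n.+1} =>
    `|Z k s / n.+1%:R - z k|)) @[n --> \oo] --> (0 : R).
  elim: (K) => [|K' IH].
    rewrite (_ : (fun _ => _) = fun=> 0); first exact: cvg_cst.
    by apply/funext => n; rewrite big_geq.
  rewrite (_ : (fun _ => _) = fun n => \sum_(0 <= k < K') perm_mean
      (fun s : {perm 'I_n.+1} => `|Z k s / n.+1%:R - z k|) +
    perm_mean (fun s : {perm 'I_n.+1} => `|Z K' s / n.+1%:R - z K'|)).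
    have h2 := cvgD IH (@cvg_mean_abs K'); rewrite addr0 in h2.
    exact: h2.
  by apply/funext => n; rewrite big_nat_recr.
near=> n.
have Kn : (K <= n.+1)%N by rewrite ltnW// ltnS; near: n; exact: nbhs_infty_ge.
rewrite ger0_norm; last first.
  by rewrite -[X in X <= _](@perm_mean_cst R n) ler_perm_mean.
apply: (@le_trans _ _ (\sum_(0 <= k < K) perm_mean (fun s : {perm 'I_n.+1} =>
      `|Z k s / n.+1%:R - z k|) +
   (\sum_(K <= k < n.+1) perm_mean (fun s : {perm 'I_n.+1} => Z k s / n.+1%:R) +
    `|h - series z K|))).
  rewrite -!perm_mean_sum -[X in _ + (_ + X)](@perm_mean_cst R n) -!perm_meanD.
  apply: ler_perm_mean => s; rewrite -/h.
  have -> : (run_entries (T n) (Y n) (word s))%:R / n.+1%:R =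
      \sum_(0 <= k < K) Z k s / n.+1%:R + \sum_(K <= k < n.+1) Z k s / n.+1%:R.
    rewrite -big_cat_nat//= -mulr_suml; congr (_ / _).
    rewrite run_entriesE size_word natr_sum -(big_mkord xpredT
      (fun k => (\sum_(a < n.+1 - k)
        good_window (T n) (Y n) (take k.+1 (drop a (word s))))%:R)).
    by [].
  set S1 := \sum_(0 <= k < K) _; set S2 := \sum_(K <= k < n.+1) _.
  have S2_ge0 : 0 <= S2 by rewrite sumr_ge0// => k _; rewrite divr_ge0.
  have -> : S1 + S2 - h = (S1 - series z K) + (S2 - (h - series z K)) by ring.
  rewrite (le_trans (ler_normD _ _))// lerD//; last first.
    by rewrite (le_trans (ler_normB _ _))// ger0_norm.
  by rewrite /S1 /series /= -sumrB ler_norm_sum.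
have -> : e = e / 3 + (e / 3 + e / 3) by field.
rewrite lerD//; last rewrite lerD//.
  rewrite (le_trans (ler_norm _))//; near: n.
  by move/cvgr0Pnorm_le : sum_cvg; exact.
apply: le_trans eK; rewrite lerBrDl.
apply: (le_trans _ (e1_le n.+1)); rewrite [leRHS](big_cat_nat _ Kn)//= lerD2l.
by rewrite !big_nat ler_sum// => k /andP[_ kn]; exact: mean_tail.
Unshelve. all: by end_near. Qed.

End window_count_limits.

(** * Convergence of the distribution functions of [Rn] *)

Section cdf_limit.
Context {R : realType}.

Lemma cvg_truncn_ratio (x : R) : 0 <= x ->
  ((Num.truncn (x * n.+1%:R))%:R / n.+1%:R : R) @[n --> \oo] --> x.
Proof.
move=> x0; have lo : (x - n.+1%:R^-1) @[n --> \oo] --> x.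
  by rewrite -[X in _ --> X]subr0; apply: cvgB; [exact: cvg_cst|exact: cvg_harmonic].
apply: (squeeze_cvgr _ lo (cvg_cst x)); apply: nearW => n.
have n0 : 0 < n.+1%:R :> R by rewrite ltr0n.
have /andP[h1 h2] := truncn_itv (mulr_ge0 x0 (ltW n0)).
rewrite ler_pdivlMr// mulrBl mulVf ?gt_eqF// ler_pdivrMr// h1 andbT.
by rewrite lerBlDr ltW// natr1.
Qed.

Lemma runsort_probE n i j : runsort_prob R n.+1 i j =
  perm_mean (fun s : {perm 'I_n.+1} =>
    (nth 0%N (runsort (word s)) i.-1 == j)%:R).
Proof.
rewrite /runsort_prob /perm_mean; congr (_ / _).
by rewrite -sum1_card natr_sum big_mkcond; apply: eq_bigr => s _; rewrite inE; case: eqP.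
Qed.

(** The lower ends -1 exclude no grid point, so this [En] is the distribution function at (x, y).
    Exchanging the mean with the sums leaves, for each position, the indicator that its entry is at
    most yn. *)
Lemma En_cdfE n (x y : R) : 0 <= x <= 1 -> 0 <= y <= 1 ->
  En n.+1 (- 1) x (- 1) y = perm_mean (fun s : {perm 'I_n.+1} =>
    (count (leq^~ (Num.truncn (y * n.+1%:R)))
       (take (Num.truncn (x * n.+1%:R)) (runsort (word s))))%:R / n.+1%:R).
Proof.
move=> /andP[x0 x1] /andP[y0 y1].
have n0 : 0 < n.+1%:R :> R by rewrite ltr0n.
have condE (z : R) (i : nat) : 0 <= z ->
    ((- 1 : R) * n.+1%:R < i%:R <= z * n.+1%:R) = (i < (Num.truncn (z * n.+1%:R)).+1)%N.
  move=> z0; rewrite ltnS truncn_ge_nat ?mulr_ge0// mulN1r.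
  by rewrite (@lt_le_trans _ _ 0) ?oppr_lt0 ?ler0n.
have truncn_le1 (z : R) : z <= 1 -> (Num.truncn (z * n.+1%:R) <= n.+1)%N.
  move=> z1; rewrite truncn_le_nat; apply: (@le_lt_trans _ _ n.+1%:R).
    by rewrite ler_piMl.
  by rewrite ltr_nat.
(* Positivity of [v] matters because j starts at 1; entries of a word are positive. *)
have sum_eq (v b : nat) : (0 < v)%N -> (\sum_(1 <= j < b.+1) (v == j) = (v <= b))%N.
  move=> v0; elim: b => [|b IH]; first by rewrite big_geq// leqn0 gtn_eqF.
  rewrite big_nat_recr//= IH [in RHS]leq_eqVlt ltnS.
  by case: eqP => [->|_]; [rewrite ltnn|rewrite addn0].
set a := Num.truncn (x * _); set b := Num.truncn (y * _).
have an : (a <= n.+1)%N by exact: truncn_le1.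
have bn : (b <= n.+1)%N by exact: truncn_le1.
have -> : En n.+1 (- 1) x (- 1) y = n.+1%:R^-1 *
    \sum_(1 <= i < a.+1) \sum_(1 <= j < b.+1) runsort_prob R n.+1 i j.
  rewrite /En; congr (_ * _).
  rewrite [RHS](big_nat_widen _ _ n.+2)//; apply: eq_big => [i|i _]; first exact: condE.
  by rewrite [RHS](big_nat_widen _ _ n.+2)//; apply: eq_bigl => j; exact: condE.
under eq_bigr => i _ do under eq_bigr do rewrite runsort_probE.
under eq_bigr do rewrite -perm_mean_sum.
rewrite -perm_mean_sum -perm_meanZ; congr perm_mean; apply/funext => s.
rewrite mulrC; congr (_ / _).
have sz : size (runsort (word s)) = n.+1.
  by rewrite (perm_size (perm_runsort _)) size_word.
under eq_bigr do rewrite -natr_sum.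
rewrite -natr_sum; congr _%:R; rewrite big_add1 /=.
rewrite -sum1_count -[take _ _](mkseq_nth 0%N) size_takel ?sz// /mkseq big_map.
rewrite [RHS]big_mkcond /= /index_iota subn0 !big_seq; apply: eq_bigr => i.
rewrite mem_iota add0n => /andP[_ ia]; rewrite nth_take// sum_eq; first by case: leq.
have inw : nth 0%N (runsort (word s)) i \in word s.
  by rewrite -(perm_mem (perm_runsort _)) mem_nth// sz (leq_trans ia).
by case/andP: (word_bounds inw).
Qed.

(** The low runs at level tn occupy about xn positions, so the first xn positions of the sorted word
    may be replaced by the low runs at the cost of [count_runsort_dist]. *)
Lemma En_cdf_cvg (t y : R) : 0 <= t <= 1 -> 0 <= y <= 1 ->
  let d := Num.max (y - t) 0 in
  En n.+1 (- 1) (t * expR (1 - t)) (- 1) y @[n --> \oo] --> (y - d) * expR d.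
Proof.
move=> t01 y01 d; have x01 := phi_itv t01; set x := t * expR (1 - t) in x01 *.
have [[t0 t1] [y0 y1]] := (andP t01, andP y01); have [x0 x1] := andP x01.
pose tr (z : R) (n : nat) := Num.truncn (z * n.+1%:R).
have tr_le (z : R) : z <= 1 -> forall n, (tr z n <= n.+1)%N.
  move=> z1 n.
  rewrite truncn_le_nat; apply: (@le_lt_trans _ _ n.+1%:R).
    by rewrite ler_piMl.
  by rewrite ltr_nat.
have cxy := run_entries_mean_abs (tr_le _ t1) (tr_le _ y1)
  (cvg_truncn_ratio t0) (cvg_truncn_ratio y0).
have cx := run_entries_mean_abs (tr_le _ t1) (fun n => leqnn n.+1)
  (cvg_truncn_ratio t0) cvg_id_ratio.
have dE : Num.max (1 - t) 0 = 1 - t by apply/max_idPl; rewrite subr_ge0.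
rewrite dE subKr -/x in cx; rewrite -/d in cxy.
(* The three errors: rounding of xn, deviation of the total length of the low runs, deviation of the
   number of their entries up to yn. *)
pose B n := `|(tr x n)%:R / n.+1%:R - x| +
  perm_mean (fun s : {perm 'I_n.+1} =>
    `|(run_entries (tr t n) n.+1 (word s))%:R / n.+1%:R - x|) +
  perm_mean (fun s : {perm 'I_n.+1} =>
    `|(run_entries (tr t n) (tr y n) (word s))%:R / n.+1%:R - (y - d) * expR d|).
have cB : B n @[n --> \oo] --> (0 : R).
  have c0 : `|(tr x n)%:R / n.+1%:R - x| @[n --> \oo] --> (0 : R).
    rewrite -(normr0 R) -(subrr x); apply: cvg_norm; apply: cvgB; last exact: cvg_cst.
    exact: cvg_truncn_ratio.
  by have := cvgD (cvgD c0 cx) cxy; rewrite !addr0; exact.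
apply/cvgrPdist_le => e e0; move/cvgr0Pnorm_le : cB => /(_ e e0).
apply: filterS => n /(le_trans (ler_norm _)); apply: le_trans.
rewrite distrC En_cdfE//; set h := (y - d) * expR d.
have n0 : 0 < n.+1%:R :> R by rewrite ltr0n.
have dist_norm (X : {perm 'I_n.+1} -> R) (c : R) :
    `|perm_mean X - c| <= perm_mean (fun s => `|X s - c|).
  rewrite -[X in `|_ - X|](@perm_mean_cst R n) -perm_meanN -perm_meanD.
  exact: ler_norm_perm_mean.
apply: le_trans (dist_norm _ _) _; rewrite /B.
rewrite -[X in X + _ + _](@perm_mean_cst R n) -!perm_meanD.
apply: ler_perm_mean => s; set c := count _ _.
have wM : all (leq^~ n.+1) (word s) by apply/allP => v /word_bounds/andP[].
have [h1 h2] := count_runsort_dist (tr t n) (tr y n) (tr x n) wM.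
rewrite -/c in h1 h2.
set r := run_entries _ (tr y n) _ in h1 h2 *; set q := run_entries _ n.+1 _ in h1 h2 *.
have cr : `|c%:R - r%:R| <= `|(tr x n)%:R - q%:R| :> R.
  have [xq|/ltnW qx] := leqP (tr x n) q.
    rewrite (distrC c%:R) (distrC (tr x n)%:R) (@ger0_norm _ (q%:R - _)) ?subr_ge0 ?ler_nat//.
    have cr : (c <= r)%N by lia.
    rewrite ger0_norm ?subr_ge0 ?ler_nat// lerBlDr -!natrB// -natrD ler_nat.
    by lia.
  rewrite (@ger0_norm _ ((tr x n)%:R - _)) ?subr_ge0 ?ler_nat//.
  have rc : (r <= c)%N by lia.
  rewrite ger0_norm ?subr_ge0 ?ler_nat// lerBlDr -!natrB// -natrD ler_nat.
  by lia.
have -> : c%:R / n.+1%:R - h = (c%:R - r%:R) / n.+1%:R + (r%:R / n.+1%:R - h).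
  by rewrite mulrBl; ring.
rewrite (le_trans (ler_normD _ _))// lerD2r.
rewrite normrM [X in _ * X]ger0_norm ?invr_ge0//.
apply: (@le_trans _ _ (`|(tr x n)%:R - q%:R| / n.+1%:R)).
  by rewrite ler_wpM2r// invr_ge0.
rewrite -{1}(@ger0_norm _ n.+1%:R^-1) ?invr_ge0// -normrM mulrBl.
have -> : (tr x n)%:R / n.+1%:R - q%:R / n.+1%:R =
    ((tr x n)%:R / n.+1%:R - x) - (q%:R / n.+1%:R - x) by ring.
exact: ler_normB.
Qed.

End cdf_limit.

(** * Distribution function of the limit *)

Section limit_cdf.
Context {R : realType}.
Local Notation mu := (@lebesgue_measure R).
Local Notation phi := (fun y : R => y * expR (1 - y)).

(** After division by e^{1 - a} the claim is a < b e^{a - b}. It follows from e^{a - b} > 1 + (a -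
    b) and b (1 + a - b) = a + (1 - b)(b - a). *)
Lemma phi_lt (a b : R) : 0 <= a -> a < b -> b <= 1 -> phi a < phi b.
Proof.
move=> a0 ab b1; have b0 : 0 < b by exact: le_lt_trans a0 ab.
have -> : 1 - b = (1 - a) + (a - b) by ring.
rewrite (expRD (1 - a)) mulrCA [a * _]mulrC ltr_pM2l ?expR_gt0//.
have h : 1 + (a - b) < expR (a - b).
  by rewrite expR_gt1Dx// ltr0_neq0// subr_lt0.
apply: (@le_lt_trans _ _ (b * (1 + (a - b)))).
  have -> : b * (1 + (a - b)) = a + (1 - b) * (b - a) by ring.
  by rewrite lerDl mulr_ge0 ?subr_ge0// ltW.
by rewrite ltr_pM2l// h.
Qed.

Lemma phi_le (a b : R) : 0 <= a <= 1 -> 0 <= b <= 1 -> (phi a <= phi b) = (a <= b).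
Proof.
move=> /andP[a0 a1] /andP[b0 b1]; case: (ltgtP a b) => [ab|ba|->]; last by rewrite lexx.
  by rewrite ltW// phi_lt.
by apply/negbTE; rewrite -ltNge phi_lt.
Qed.

Lemma integral_expR_shift (t y : R) : t <= y ->
  (\int[mu]_(z in `[t, y]) (t * expR (z - t))%:E = (t * expR (y - t) - t)%:E)%E.
Proof.
rewrite le_eqVlt => /predU1P[->|ty].
  by rewrite set_itv1 integral_set1 subrr expR0 mulr1 subrr.
pose F (z : R) : R := t * expR (z - t).
have dF z : is_derive z (1 : R) F (t * expR (z - t)).
  by apply: is_derive_eq; rewrite /GRing.scale /= subr0 mulr1.
have drF z : derivable F z (1 : R) by have ? := dF z; exact: ex_derive.
have cF z : {for z, continuous F}.
  by apply: differentiable_continuous; apply/derivable1_diffP; exact: drF.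
rewrite (@continuous_FTC2 _ F F)//.
- by rewrite -EFinD /F subrr expR0 mulr1.
- by apply: continuous_subspaceT => z; exact: cF.
- split; first by move=> z _; exact: drF.
  + by apply: cvg_at_right_filter; exact: cF.
  + by apply: cvg_at_left_filter; exact: cF.
- by move=> z _; rewrite derive1E; have ? := dF z; exact: derive_val.
Qed.

(** The density e^{y - 1} times the length min(phi(t), phi(y)) of the horizontal section at height y
    of the part of the rectangle inside [Cplus]. *)
Let section_val (t y : R) : R := if y <= t then y else t * expR (y - t).

Let rect (t y : R) : set (plane R) := `]-1, phi t] `*` `]-1, y].

Let first_integral (t y : R) : 0 <= t <= 1 -> 0 <= y <= 1 ->
  (\int[mu \x mu]_(z in rect t y `&` @Cplus R) (expR (z.2 - 1))%:E =
   \int[mu]_(z in `[0%R, y]) (section_val t z)%:E)%E.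
Proof.
move=> t01 y01; have /andP[t0 t1] := t01; have /andP[y0 y1] := y01.
have mrect : measurable (rect t y) by exact: measurableX.
rewrite integral_mkcond fubini_tonelli2; last 2 first.
- apply: (proj1 (measurable_restrictT _ (measurableI _ _ mrect measurable_Cplus))).
  apply/measurable_EFinP/measurable_funTS; apply: measurableT_comp => //.
  by apply: measurable_funB.
- by move=> z; apply: erestrict_ge0 => ? _; rewrite lee_fin expR_ge0.
rewrite [RHS]integral_mkcond; apply: eq_integral => z _.
rewrite /fubini_G /= [RHS]patchE mem_setE in_itv/=.
have memE x : ((x, z) \in rect t y `&` @Cplus R) =
    (0 <= z <= y) && (0 <= x <= phi t) && (x < phi z).
  apply/idP/idP; rewrite inE.
    move=> -[[/=]]; rewrite !in_itv/= => /andP[_ xt] /andP[_ zy].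
    move=> [[/= /andP[x0 _] /andP[z0 _]] xz].
    by rewrite z0 zy x0 xt.
  move=> /andP[/andP[/andP[z0 zy] /andP[x0 xt]] xz].
  have /andP[_ phit1] := phi_itv t01.
  split.
    split; rewrite /= in_itv/=.
      by rewrite xt andbT (lt_le_trans _ x0)// ltrN10.
    by rewrite zy andbT (lt_le_trans _ z0)// ltrN10.
  split => //; split => /=; first by rewrite x0 (le_trans xt).
  by rewrite z0 (le_trans zy).
case: ifPn => zy; last first.
  by apply: integral0_eq => x _; rewrite patchE memE (negbTE zy).
have /andP[z0 zy'] := zy.
have z01 : 0 <= z <= 1 by rewrite z0 (le_trans zy').
have [/andP[phit0 _] /andP[phiz0 _]] := (phi_itv t01, phi_itv z01).
have itv_cst b (c : R) : 0 <= c ->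
    (\int[mu]_(x in [set` Interval (BLeft 0%R) (BSide b c)]) (expR (z - 1))%:E =
     (expR (z - 1) * c)%:E)%E.
  move=> c0; rewrite integral_cst//= lebesgue_measure_itv/= lte_fin.
  case: ltP => [_|c0']; first by rewrite sube0.
  have cE : c = 0 by apply/le_anti; rewrite c0 c0'.
  by rewrite cE mulr0 mule0.
rewrite /section_val; case: ifPn => [zt|]; last rewrite -ltNge => tz.
  transitivity (\int[mu]_(x in `[0%R, phi z[) (expR (z - 1))%:E)%E.
    rewrite [RHS]integral_mkcond; apply: eq_integral => x _.
    rewrite !patchE memE zy mem_setE in_itv/=; congr (if _ then _ else _).
    case: (ltP x (phi z)) => xz; rewrite ?andbF// !andbT.
    by rewrite (le_trans (ltW xz)) ?andbT// phi_le.
  rewrite itv_cst// mulrCA -expRD (_ : z - 1 + (1 - z) = 0) ?expR0 ?mulr1//.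
  by ring.
transitivity (\int[mu]_(x in `[0%R, phi t]) (expR (z - 1))%:E)%E.
  rewrite [RHS]integral_mkcond; apply: eq_integral => x _.
  rewrite !patchE memE zy mem_setE in_itv/=; congr (if _ then _ else _).
  case: (leP x (phi t)) => xt; rewrite ?andbF// !andbT.
  rewrite (le_lt_trans xt) ?andbT// phi_lt//.
  by rewrite (le_trans zy').
rewrite itv_cst// mulrCA -expRD; congr (_ * expR _)%:E.
by ring.
Qed.

(** Up to height m = min(t, y) the area and the curve contribute z and 1 - z, together m. Between t
    and y only the area counts and adds the integral of t e^{z - t}. *)
Lemma Rlim_cdf (t y : R) : 0 <= t <= 1 -> 0 <= y <= 1 ->
  let d := Num.max (y - t) 0 in
  Rlim (`]-1, t * expR (1 - t)] `*` `]-1, y] : set (plane R)) =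
    ((y - d) * expR d)%:E.
Proof.
move=> t01 y01 d; have /andP[t0 t1] := t01; have /andP[y0 y1] := y01.
rewrite /Rlim first_integral// curve_snd.
pose m := Num.min t y.
have m0 : 0 <= m by rewrite le_min t0.
(* As phi increases on [0, 1], the curve point at height z lies in the rectangle exactly when z <= t
   and z <= y. *)
have -> : `[0, 1] `&` (fun z : R => (phi z, z)) @^-1`
    (`]-1, t * expR (1 - t)] `*` `]-1, y]) = `[0, m]%classic.
  apply/seteqP; split => z /=; rewrite !in_itv/=.
    move=> [z01 [/andP[_ + ] /andP[_ zy]]].
    by rewrite phi_le// le_min zy => ->; case/andP: z01 => ->.
  rewrite le_min => /andP[z0 /andP[zt zy]].
  have z01 : 0 <= z <= 1 by rewrite z0 (le_trans zy).
  have /andP[phiz0 _] := phi_itv z01.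
  split => //; split; rewrite ?phi_le ?zt ?zy ?andbT//.
    by rewrite (lt_le_trans _ phiz0)// ltrN10.
  by rewrite (lt_le_trans _ z0)// ltrN10.
have mlin : measurable_fun setT (fun z : R => 1 - z) by exact: measurable_funB.
have one : (\int[mu]_(z in `[0%R, m]) z%:E + \int[mu]_(z in `[0%R, m]) (1 - z)%:E = m%:E)%E.
  rewrite -ge0_integralD//; first last.
  - by apply/measurable_EFinP; exact: measurable_funTS.
  - move=> z; rewrite /= in_itv/= lee_fin subr_ge0 le_min => /andP[_ /andP[zt _]].
    exact: le_trans t1.
  - by move=> z; rewrite /= in_itv/= lee_fin => /andP[].
  under eq_integral do rewrite -EFinD addrC subrK.
  rewrite integral_cst//= mul1e lebesgue_measure_itv/= lte_fin.
  case: ltP => [_|m0']; first by rewrite sube0.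
  by congr EFin; apply/le_anti; rewrite m0 m0'.
have [yt|ty] := leP y t.
  have mE : m = y by apply/min_idPr.
  have dE : d = 0 by apply/max_idPr; rewrite subr_le0.
  rewrite dE subr0 expR0 mulr1 -[in RHS]mE -one mE; congr (_ + _)%E.
  apply: eq_integral => z; rewrite inE/= in_itv/= => /andP[_ zy].
  by rewrite /section_val (le_trans zy yt).
have mE : m = t by apply/min_idPl; exact: ltW.
have dE : d = y - t by apply/max_idPl; rewrite subr_ge0 ltW.
rewrite dE subKr.
have msec : measurable_fun setT (section_val t).
  apply: measurable_fun_ifT => //.
    by apply: measurable_fun_ler.
  apply: measurable_funM => //; apply: measurableT_comp => //.
  exact: measurable_funB.
have -> : `[0, y]%classic = `[0, t] `|` `]t, y].
  by rewrite -itv_bndbnd_setU// bnd_simp// ltW.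
rewrite ge0_integral_setU//; last 3 first.
- by apply/measurable_EFinP; exact: measurable_funTS.
- move=> z; rewrite /= !in_itv/= lee_fin /section_val => h.
  case: ifPn => zt; last by rewrite mulr_ge0 ?expR_ge0.
  by case: h => [/andP[]//|/andP[/(le_lt_trans zt)]]; rewrite ltxx.
- apply/disj_setPS => z /= []; rewrite !in_itv/= => /andP[_ zt] /andP[tz _].
  by have := le_lt_trans zt tz; rewrite ltxx.
have -> : (\int[mu]_(z in `[0%R, t]) (section_val t z)%:E =
    \int[mu]_(z in `[0%R, t]) z%:E)%E.
  apply: eq_integral => z; rewrite inE/= in_itv/= => /andP[_ zt].
  by rewrite /section_val zt.
have -> : (\int[mu]_(z in `]t, y]) (section_val t z)%:E =
    (t * expR (y - t) - t)%:E)%E.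
  rewrite -integral_expR_shift ?ltW// -integral_itv_obnd_cbnd; last first.
    apply/measurable_EFinP/measurable_funTS; apply: measurable_funM => //.
    by apply: measurableT_comp => //; exact: measurable_funB.
  apply: eq_integral => z; rewrite inE/= in_itv/= => /andP[tz _].
  by rewrite /section_val leNgt tz.
rewrite mE in one *; rewrite addeAC one -EFinD; congr EFin; ring.
Qed.

End limit_cdf.

(** * Weak convergence from convergence of distribution functions *)

Section weak_convergence.
Context {R : realType}.
Local Notation sq := (@unit_square R).

Lemma compact_unit_square : compact (sq : set (R * R)).
Proof.
rewrite (_ : (sq : set (R * R)) = `[0, 1] `*` `[0, 1]).
  by apply: compact_setX; exact: segment_compact.
by apply/seteqP; split => -[a b] /= [h1 h2]; split; move: h1 h2;
  rewrite /= !in_itv.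
Qed.

(** Uniform continuity by compactness, with a modulus of the form 1 / (M + 1) that serves as the
    mesh of the grid. *)
Lemma unit_square_unif_continuous (f : R * R -> R) (e : R) :
  {within sq, continuous f} -> 0 < e ->
  exists M : nat, forall z w : R * R, sq z -> sq w ->
    `|z.1 - w.1| <= M.+1%:R^-1 -> `|z.2 - w.2| <= M.+1%:R^-1 ->
    `|f z - f w| <= e.
Proof.
move=> /subspace_continuousP cf e0; have e2 : 0 < e / 2 by rewrite divr_gt0.
pose P (M : nat) (z : R * R) := forall w : R * R, sq z -> sq w ->
    `|z.1 - w.1| <= M.+1%:R^-1 -> `|z.2 - w.2| <= M.+1%:R^-1 ->
    `|f z - f w| <= e.
have : \forall M \near \oo, sq `<=` P M.
  apply: (proj1 (compact_near_coveringP _) compact_unit_square nat \oo P) => z sqz.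
  have /cvgrPdist_lt/(_ _ e2) := cf _ sqz.
  rewrite near_withinE => /nbhs_ballP[r /= r0 hr].
  have r2 : 0 < r / 2 by rewrite divr_gt0.
  (* Both z' and w stay in the ball of radius r around z: z' is within r / 2 of z, and w within 1 /
     (M + 1) < r / 2 of z'. *)
  near=> z' M => w sqz' sqw h1 h2.
  have zz' : ball z (r / 2) z' by near: z'; apply: nbhsx_ballx.
  have Mr : M.+1%:R^-1 < r / 2.
    near: M; have := @cvg_harmonic R => /cvgr0Pnorm_lt/(_ _ r2).
    by apply: filterS => m; apply: le_lt_trans; exact: ler_norm.
  have z'w : ball z' (r / 2) w.
    by split => /=; rewrite /ball/=; [exact: le_lt_trans h1 Mr|exact: le_lt_trans h2 Mr].
  have fz' : `|f z - f z'| < e / 2.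
    by apply: hr => //; apply: le_ball zz'; rewrite ler_pdivrMr// ler_peMr ?ler1n// ltW.
  have fw : `|f z - f w| < e / 2.
    by apply: hr => //; rewrite (splitr r); exact: ball_triangle zz' z'w.
  have -> : f z' - f w = (f z - f w) - (f z - f z') by ring.
  by rewrite (le_trans (ler_normB _ _))// ltW// (splitr e) ltrD.
move=> /filter_ex[M hM]; exists M => z w sqz; exact: hM.
Unshelve. all: by end_near. Qed.

(** Index 0 gives the interval ]-1, 0], which catches the coordinate 0, so that half-open intervals
    cover all of [0, 1]. *)
Definition cell_lo (M i : nat) : R := if i is k.+1 then k%:R / M.+1%:R else - 1.

Definition cell_hi (M i : nat) : R := i%:R / M.+1%:R.

Definition cell (M : nat) (p : 'I_M.+2 * 'I_M.+2) : set (plane R) :=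
  `]cell_lo M p.1, cell_hi M p.1] `*` `]cell_lo M p.2, cell_hi M p.2].

Definition step (f : R * R -> R) (M : nat) (z : plane R) : R :=
  \sum_(p : 'I_M.+2 * 'I_M.+2) f (cell_hi M p.1, cell_hi M p.2) * \1_(cell p) z.

Lemma measurable_cell M p : measurable (@cell M p).
Proof. exact: measurableX. Qed.

Lemma measurable_step f M (D : set (plane R)) : measurable_fun D (step f M).
Proof.
apply: measurable_funTS; rewrite /step; apply: measurable_sum => p.
by apply: measurable_funM => //; apply: measurable_indic; exact: measurable_cell.
Qed.

Lemma cell_hi_itv M (i : 'I_M.+2) : 0 <= cell_hi M i <= 1.
Proof.
by rewrite divr_ge0//= ler_pdivrMr ?ltr0n// mul1r ler_nat -ltnS ltn_ord.
Qed.

Lemma cell_lo_itv M (i : 'I_M.+2) : cell_lo M i = - 1 \/ 0 <= cell_lo M i <= 1.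
Proof.
case: i => -[|i] ilt /=; first by left.
by right; rewrite divr_ge0//= ler_pdivrMr ?ltr0n// mul1r ler_nat; lia.
Qed.

Lemma cell_lo_le M (i : nat) : cell_lo M i <= cell_hi M i.
Proof.
rewrite /cell_lo /cell_hi; case: i => [|i]; first by rewrite mul0r lerN10.
by rewrite ler_pM2r ?invr_gt0 ?ltr0n// ler_nat.
Qed.

(** The index is the least one with x <= [cell_hi M i]; minimality yields both the lower bound and
    uniqueness. *)
Lemma cell_coord M (x : R) : 0 <= x <= 1 -> exists i : 'I_M.+2,
  [/\ cell_lo M i < x, x <= cell_hi M i, `|x - cell_hi M i| <= M.+1%:R^-1 &
    forall j : 'I_M.+2, cell_lo M j < x <= cell_hi M j -> j = i].
Proof.
move=> /andP[x0 x1]; have M0 : 0 < M.+1%:R :> R by rewrite ltr0n.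
have ex : exists i, x <= cell_hi M i.
  by exists M.+1; rewrite /cell_hi divff// gt_eqF.
have mono i j : (i <= j)%N -> cell_hi M i <= cell_hi M j.
  by move=> ij; rewrite ler_pM2r ?invr_gt0// ler_nat.
case: (ex_minnP ex) => i xi imin.
have iM : (i < M.+2)%N by rewrite ltnS imin// /cell_hi divff// gt_eqF.
have loi : cell_lo M i < x.
  case: i xi imin {iM} => [|i] xi imin /=; first by rewrite (lt_le_trans _ x0)// ltrN10.
  by rewrite ltNge; apply/negP => /imin; rewrite ltnn.
exists (Ordinal iM); split => //=.
  rewrite distrC ger0_norm ?subr_ge0//; move: loi xi; rewrite /cell_hi.
  case: (i) => [|k] /= loi xi.
    (* The interval of index 0 is longer than the mesh, but its only point in [0, 1] is 0. *)
    have -> : x = 0 by apply/le_anti; rewrite x0 andbT; move: xi; rewrite mul0r.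
    by rewrite mul0r subr0 invr_ge0 ltW.
  by rewrite lerBlDr -natr1 mulrDl mul1r addrC lerD2l ltW.
move=> j /andP[jx xj]; apply: val_inj => /=; apply/eqP; rewrite eqn_leq imin// andbT.
case: j jx {xj} => -[//|j] jlt /= jx; rewrite ltnNge; apply/negP => ij.
by have := lt_le_trans jx (le_trans xi (mono _ _ ij)); rewrite ltxx.
Qed.

Lemma step_approx (f : R * R -> R) (e : R) : {within sq, continuous f} ->
  0 < e -> exists M, forall z, sq z -> `|f z - step f M z| <= e.
Proof.
move=> cf e0; have [M hM] := unit_square_unif_continuous cf e0.
exists M => -[x y] sqxy; have [/= x01 y01] := sqxy.
have [i [lox xhi xi iuniq]] := cell_coord M x01.
have [j [loy yhi yj juniq]] := cell_coord M y01.
have cellE (p : 'I_M.+2 * 'I_M.+2) : ((x, y) \in cell p) = (p == (i, j)).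
  apply/idP/eqP; rewrite inE /cell /=.
    case: p => a b [/=]; rewrite !in_itv/= => /iuniq -> /juniq ->.
    by [].
  by move=> -> /=; split; rewrite /= in_itv/= ?lox ?loy.
rewrite /step (bigD1 (i, j))//= [X in _ - (_ + X)]big1; last first.
  by move=> p pij; rewrite indicE cellE (negbTE pij) mulr0.
rewrite addr0 indicE cellE eqxx mulr1; apply: hM => //.
by split => /=; exact: cell_hi_itv.
Qed.

(** On the square [f] is a pointwise limit of step functions. *)
Lemma measurable_unit_square_continuous (f : R * R -> R) :
  {within sq, continuous f} -> measurable_fun sq (f : plane R -> R).
Proof.
move=> cf.
have /choice[M hM] : forall k : nat, exists M, forall z, sq z ->
    `|f z - step f M z| <= k.+1%:R^-1.
  by move=> k; apply: step_approx; rewrite ?invr_gt0.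
apply: (@measurable_fun_cvg _ _ _ _ (fun k => step f (M k))).
  by move=> k; exact: measurable_step.
move=> z sqz; apply/cvgrPdist_le => e e0.
have := @cvg_harmonic R => /cvgr0Pnorm_le/(_ _ e0); apply: filterS => k.
by move=> /(le_trans (ler_norm _)); apply: le_trans; exact: hM.
Qed.

(** * Integrals of step functions against a probability carried by the square *)

Section step_integral.
Variable P : probability (plane R) R.
Hypothesis Psq : P sq = 1%E.

Let P_sq_lty : (P sq < +oo)%E. Proof. by rewrite Psq ltry. Qed.

Let msq := @measurable_unit_square R.

(** Cells with an index 0 stick out of the square; the excess lies in its complement, a null set. *)
Lemma probability_setI_sq (A : set (plane R)) : measurable A -> P (A `&` sq) = P A.
Proof.
move=> mA; rewrite -[in RHS](setIT A) -(setUv sq) setIUr measureU//; last 3 first.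
- exact: measurableI.
- by apply: measurableI => //; exact: measurableC.
- by rewrite setIACA setICr setI0.
have Pc : P (~` sq) = 0%E by rewrite probability_setC// Psq subee.
suff h : P (A `&` ~` sq) = 0%E by rewrite [X in (_ + X)%E]h adde0.
apply/eqP; rewrite eq_le measure_ge0 andbT -Pc le_measure// ?inE.
- by apply: measurableI => //; exact: measurableC.
- exact: measurableC.
Qed.

Lemma bounded_integrable_sq (f : plane R -> R) : measurable_fun sq f ->
  (exists B, forall z, sq z -> `|f z| <= B) -> P.-integrable sq (EFin \o f).
Proof.
move=> mf [B fB]; apply: measurable_bounded_integrable => //.
exists B; split; first exact: num_real.
by move=> C BC z /= sqz; rewrite (le_trans (fB _ sqz))// ltW.
Qed.

Lemma Rintegral_step (f : R * R -> R) M :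
  P.-integrable sq (EFin \o step f M) /\
  \int[P]_(z in sq) step f M z = \sum_(p : 'I_M.+2 * 'I_M.+2)
    f (cell_hi M p.1, cell_hi M p.2) * fine (P (cell p)).
Proof.
pose g (p : 'I_M.+2 * 'I_M.+2) (z : plane R) : R :=
  f (cell_hi M p.1, cell_hi M p.2) * \1_(cell p) z.
have mind p : measurable_fun sq (\1_(@cell M p) : plane R -> R).
  by apply: measurable_indic; exact: measurable_cell.
have iind p : P.-integrable sq (EFin \o \1_(@cell M p)).
  apply: bounded_integrable_sq => //.
  by exists 1 => z _; rewrite indicE; case: (_ \in _); rewrite ?normr1 ?normr0.
have ig p : P.-integrable sq (EFin \o g p).
  apply: bounded_integrable_sq; first exact: measurable_funM.
  exists `|f (cell_hi M p.1, cell_hi M p.2)| => z _.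
  by rewrite /g normrM indicE; case: (_ \in _); rewrite ?normr1 ?normr0 ?mulr1 ?mulr0.
have gE p : \int[P]_(z in sq) g p z =
    f (cell_hi M p.1, cell_hi M p.2) * fine (P (cell p)).
  rewrite RintegralZl//; congr (_ * _).
  rewrite /Rintegral integral_indic//; last exact: measurable_cell.
  by rewrite [X in fine X]probability_setI_sq//; exact: measurable_cell.
have stepE : step f M = fun z => \sum_p g p z by [].
have iS : P.-integrable sq (EFin \o step f M).
  apply: bounded_integrable_sq; first exact: measurable_step.
  exists (\sum_(p : 'I_M.+2 * 'I_M.+2) `|f (cell_hi M p.1, cell_hi M p.2)|).
  move=> z _; rewrite (le_trans (ler_norm_sum _ _ _))// ler_sum// => p _.
  by rewrite normrM indicE; case: (_ \in _); rewrite ?normr1 ?normr0 ?mulr1 ?mulr0.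
split => //; rewrite /Rintegral.
under eq_integral do rewrite stepE -sumEFin.
rewrite integral_sum//.
rewrite (eq_bigr (fun p : 'I_M.+2 * 'I_M.+2 =>
    (f (cell_hi M p.1, cell_hi M p.2) * fine (P (cell p)))%:E)); last first.
  by move=> p _; rewrite -gE /Rintegral fineK//; exact: (integrable_fin_num msq (ig p)).
by rewrite sumEFin.
Qed.

Lemma continuous_integrable_sq (f : R * R -> R) : {within sq, continuous f} ->
  P.-integrable sq (EFin \o f).
Proof.
move=> cf; apply: bounded_integrable_sq.
  exact: measurable_unit_square_continuous.
have [M hM] := step_approx cf ltr01.
exists (1 + \sum_(p : 'I_M.+2 * 'I_M.+2) `|f (cell_hi M p.1, cell_hi M p.2)|).
move=> z sqz; have -> : f z = (f z - step f M z) + step f M z by ring.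
rewrite (le_trans (ler_normD _ _))// lerD ?hM//.
rewrite (le_trans (ler_norm_sum _ _ _))// ler_sum// => p _.
by rewrite normrM indicE; case: (_ \in _); rewrite ?normr1 ?normr0 ?mulr1 ?mulr0.
Qed.

Lemma step_integral_dist (f : R * R -> R) (e : R) M : {within sq, continuous f} ->
  (forall z, sq z -> `|f z - step f M z| <= e) ->
  `|\int[P]_(z in sq) f z - \sum_(p : 'I_M.+2 * 'I_M.+2)
      f (cell_hi M p.1, cell_hi M p.2) * fine (P (cell p))| <= e.
Proof.
move=> cf fe; have [iS <-] := Rintegral_step f M.
have iF := continuous_integrable_sq cf.
rewrite -RintegralB//.
have mB : measurable_fun sq (fun z : plane R => f z - step f M z).
  apply: measurable_funB; last exact: measurable_step.
  exact: measurable_unit_square_continuous.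
have iB : P.-integrable sq (EFin \o (fun z => f z - step f M z)).
  by apply: bounded_integrable_sq => //; exists e.
apply: (le_trans (le_normr_Rintegral msq iB)).
apply: (@le_trans _ _ (\int[P]_(z in sq) e)).
  apply: le_Rintegral => //.
    apply: bounded_integrable_sq.
      exact: measurableT_comp.
    by exists e => z sqz; rewrite normr_id; exact: fe.
  apply: bounded_integrable_sq => //.
  by exists `|e|.
by rewrite Rintegral_cst// [X in fine X]Psq mulr1.
Qed.

End step_integral.

(** * From distribution functions to cells and test functions *)

Section cdf_to_weak.
Variables (P_ : nat -> probability (plane R) R) (P : probability (plane R) R).
Hypotheses (P_sq : forall n, P_ n sq = 1%E) (Psq : P sq = 1%E).
Hypothesis cdf_cvg : forall x y : R, 0 <= x <= 1 -> 0 <= y <= 1 ->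
  fine (P_ n (`]-1, x] `*` `]-1, y])) @[n --> \oo] -->
    fine (P (`]-1, x] `*` `]-1, y])).

Let cvgD_sub (A B : set (plane R)) : measurable A -> measurable B -> A `<=` B ->
  fine (P_ n A) @[n --> \oo] --> fine (P A) ->
  fine (P_ n B) @[n --> \oo] --> fine (P B) ->
  fine (P_ n (B `\` A)) @[n --> \oo] --> fine (P (B `\` A)).
Proof.
move=> mA mB AB cA cB.
have diffE (Q : probability (plane R) R) :
    fine (Q (B `\` A)) = fine (Q B) - fine (Q A).
  rewrite measureD//; last by rewrite ltey_eq fin_num_measure.
  by rewrite (setIidr AB) fineB//; exact: fin_num_measure.
rewrite diffE (_ : (fun n => _) = fun n => fine (P_ n B) - fine (P_ n A)).
  exact: cvgB.
by apply/funext => n; rewrite diffE.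
Qed.

(** A cell arises from boxes with lower corner (-1, -1) by two proper differences, first in the
    horizontal direction, giving [strip], then in the vertical one. *)
Lemma cell_cvg M (p : 'I_M.+2 * 'I_M.+2) :
  fine (P_ n (cell p)) @[n --> \oo] --> fine (P (cell p)).
Proof.
(* An upper end equal to -1, the lower end of the cells of index 0, makes the box empty. *)
have cdf_cvg' x y : x = - 1 \/ 0 <= x <= 1 -> y = - 1 \/ 0 <= y <= 1 ->
    fine (P_ n (`]-1, x] `*` `]-1, y])) @[n --> \oo] -->
    fine (P (`]-1, x] `*` `]-1, y])).
  have z0 (A : set (plane R)) : A = set0 ->
      fine (P_ n A) @[n --> \oo] --> fine (P A).
    move=> ->; have fine0 (Q : probability (plane R) R) : fine (Q set0) = 0.
      by rewrite measure0.
    rewrite fine0 (_ : (fun n => _) = fun=> 0); first exact: cvg_cst.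
    by apply/funext => n; exact: fine0.
  move=> [->|x01]; first by move=> _; apply: z0; rewrite set_itvoc0 set0X.
  move=> [->|y01]; last exact: cdf_cvg.
  by apply: z0; rewrite set_itvoc0 setX0.
have mX (a b c d : R) : measurable (`]a, b] `*` `]c, d] : set (plane R)).
  exact: measurableX.
have hi1 := cell_hi_itv p.1; have hi2 := cell_hi_itv p.2.
have lo1 := cell_lo_itv p.1; have lo2 := cell_lo_itv p.2.
have le1 := cell_lo_le M p.1; have le2 := cell_lo_le M p.2.
rewrite /cell; move: (cell_lo M p.1) (cell_hi M p.1) hi1 lo1 le1 => a b b01 a01 ab.
move: (cell_lo M p.2) (cell_hi M p.2) hi2 lo2 le2 => c d d01 c01 cd.
have strip y : y = - 1 \/ 0 <= y <= 1 ->
    fine (P_ n (`]a, b] `*` `]-1, y])) @[n --> \oo] -->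
    fine (P (`]a, b] `*` `]-1, y])).
  move=> y01.
  have -> : `]a, b] `*` `]-1, y] =
      (`]-1, b] `*` `]-1, y]) `\` (`]-1, a] `*` `]-1, y]) :> set (plane R).
    apply/seteqP; split => -[u v]; rewrite /= !in_itv/=.
      move=> [/andP[au ub] vy]; split.
        split => //; rewrite ub andbT (le_lt_trans _ au)//.
        by case: a01 => [->//|/andP[a0 _]]; rewrite (le_trans _ a0)// lerN10.
      by move=> [/andP[_]]; rewrite leNgt au.
    move=> [[/andP[u1 ub] vy] h]; split => //; rewrite ub andbT ltNge.
    by apply/negP => ua; apply: h; split => //; rewrite u1.
  apply: cvgD_sub => //.
  - move=> -[u v]; rewrite /= !in_itv/= => -[/andP[u1 ua] vy].
    by rewrite u1 (le_trans ua).
  - exact: cdf_cvg'.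
  - by apply: cdf_cvg' => //; right.
have -> : `]a, b] `*` `]c, d] =
    (`]a, b] `*` `]-1, d]) `\` (`]a, b] `*` `]-1, c]) :> set (plane R).
  apply/seteqP; split => -[u v]; rewrite /= !in_itv/=.
    move=> [uab /andP[cv vd]]; split.
      split => //; rewrite vd andbT (le_lt_trans _ cv)//.
      by case: c01 => [->//|/andP[c0 _]]; rewrite (le_trans _ c0)// lerN10.
    by move=> [_ /andP[_]]; rewrite leNgt cv.
  move=> [[uab /andP[v1 vd]] h]; split => //; rewrite vd andbT ltNge.
  by apply/negP => vc; apply: h; split => //; rewrite v1.
apply: cvgD_sub => //.
- move=> -[u v]; rewrite /= !in_itv/= => -[uab /andP[v1 vc]].
  by split => //; rewrite v1 (le_trans vc).
- exact: strip.
- by apply: strip; right.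
Qed.

(** Replacing [f] by one step function costs at most e / 3 under every measure involved, uniformly
    in n; the integral of the step function is a finite combination of cell masses, which
    converge. *)
Lemma cdf_weak_cvg : weak_cvg P_ P.
Proof.
move=> f cf.
have intE (Q : probability (plane R) R) : Q sq = 1%E ->
    (\int[Q]_(z in sq) (f z)%:E = (\int[Q]_(z in sq) f z)%:E)%E.
  move=> Qsq; rewrite /Rintegral fineK//.
  exact: (integrable_fin_num measurable_unit_square (continuous_integrable_sq Qsq cf)).
rewrite intE// (_ : (fun n => _) = fun n => (\int[P_ n]_(z in sq) f z)%:E); last first.
  by apply/funext => n; rewrite intE.
apply: cvg_EFin; first exact: nearW.
apply/cvgrPdist_le => e e0; have e3 : 0 < e / 3 by rewrite divr_gt0.
have [M hM] := step_approx cf e3.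
pose J (Q : probability (plane R) R) := \sum_(p : 'I_M.+2 * 'I_M.+2)
      f (cell_hi M p.1, cell_hi M p.2) * fine (Q (cell p)).
have cJ : J (P_ n) @[n --> \oo] --> J P.
  rewrite /J; elim: (index_enum _) => [|p s IH].
    rewrite big_nil (_ : (fun n => _) = fun=> 0); first exact: cvg_cst.
    by apply/funext => n; rewrite big_nil.
  rewrite big_cons (_ : (fun n => _) = fun n =>
      f (cell_hi M p.1, cell_hi M p.2) * fine (P_ n (cell p)) +
      \sum_(q <- s) f (cell_hi M q.1, cell_hi M q.2) * fine (P_ n (cell q))).
    apply: cvgD; last exact: IH.
    by apply: cvgM; [exact: cvg_cst|exact: cell_cvg].
  by apply/funext => n; rewrite big_cons.
have := cJ => /cvgrPdist_le/(_ _ e3); apply: filterS => n Jn /=.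
have h1 := step_integral_dist Psq cf hM.
have h2 := step_integral_dist (P_sq n) cf hM.
rewrite -/(J P) in h1; rewrite -/(J (P_ n)) distrC in h2.
set I := \int[P]_(z in sq) f z in h1 *; set In := \int[P_ n]_(z in sq) f z in h2 *.
have -> : I - In = (I - J P) + ((J P - J (P_ n)) + (J (P_ n) - In)) by ring.
have -> : e = e / 3 + (e / 3 + e / 3) by field.
rewrite (le_trans (ler_normD _ _))// lerD// (le_trans (ler_normD _ _))//.
by rewrite lerD.
Qed.

End cdf_to_weak.

End weak_convergence.

Theorem theorem2p5 (R : realType) :
  weak_cvg (fun n : nat => @Rn R n.+1) (@Rlim R).
Proof.
apply: cdf_weak_cvg.
- by move=> n; exact: Rn_unit_square.
- exact: Rlim_unit_square.
move=> x y x01 y01.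
pose phi := fun u : R => u * expR (1 - u).
have phi_cont : continuous phi.
  move=> u; apply: cvgM; first exact: cvg_id.
  apply: continuous_comp; last exact: continuous_expR.
  by apply: cvgB; [exact: cvg_cst|exact: cvg_id].
(* Every abscissa in [0, 1] is a value of phi, as phi(0) = 0 and phi(1) = 1, so the limits at
   (phi(t), y) cover the whole square. *)
have [t t01 <-] : exists2 t, 0 <= t <= 1 & phi t = x.
  have [t + tx] : exists2 t, t \in `[0, 1]%R & phi t = x.
    apply: IVT => //; first by apply: continuous_subspaceT => u; exact: phi_cont.
    rewrite /phi mul0r subrr expR0 mulr1.
    by rewrite (min_idPl ler01) (max_idPr ler01).
  by rewrite in_itv/= => t01; exists t.
rewrite [X in _ --> fine X](Rlim_cdf t01 y01) /=.
rewrite (_ : (fun n => _) = fun n => En n.+1 (- 1) (phi t) (- 1) y).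
  exact: En_cdf_cvg.
by apply/funext => n; rewrite Rn_rect.
Qed.
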